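(* Let $\varphi\colon\mathbb{R}^n\to\overline{\mathbb{R}}$ be fully subamenable at $\bar x\in\operatorname{dom}\varphi$, with local representation $\varphi=\vartheta\circ f$. Then $\varphi$ is properly twice epi-differentiable at $\bar x$ for every $\bar v\in\partial\varphi(\bar x)$, and its second subderivative is calculated by $$\mathrm{d}^2\varphi(\bar x,\bar v)(w)=\max_{\lambda\in\Lambda(\bar x,\bar v)}\big\{\mathrm{d}^2\vartheta\big(f(\bar x),\lambda\big)\big(\nabla f(\bar x)w\big)+\langle\lambda,\nabla^2f(\bar x)(w,w)\rangle\big\}\quad\text{for all }w\in\mathbb{R}^n,$$ where $\Lambda(\bar x,\bar v):=\{\lambda\in\mathbb{R}^m\mid\nabla f(\bar x)^*\lambda=\bar v,\ \lambda\in\partial\vartheta(f(\bar x))\}$.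
   Context: $\overline{\mathbb{R}}:=(-\infty,\infty]$, $\operatorname{dom}\varphi:=\{x\mid\varphi(x)<\infty\}$, $\operatorname{epi}\varphi:=\{(x,\alpha)\mid\alpha\ge\varphi(x)\}$; $^*$ denotes transpose. A mapping $f$ is twice differentiable at $\bar x$ if it is differentiable in a neighborhood of $\bar x$ and $\nabla f$ is differentiable at $\bar x$; $\nabla^2f(\bar x)(w,v):=(\langle\nabla^2f_1(\bar x)w,v\rangle,\ldots,\langle\nabla^2f_m(\bar x)w,v\rangle)$. $\vartheta\colon\mathbb{R}^m\to\overline{\mathbb{R}}$ is piecewise linear-quadratic (PWLQ) if $\operatorname{dom}\vartheta=\bigcup_{i=1}^s\Omega_i$ with polyhedral convex sets $\Omega_i$ and $\vartheta(y)=\frac12\langle A_iy,y\rangle+\langle a_i,y\rangle+\alpha_i$ for $y\in\Omega_i$, with symmetric matrices $A_i$, $a_i\in\mathbb{R}^m$, $\alpha_i\in\mathbb{R}$. $\varphi$ is fully subamenable at $\bar x\in\operatorname{dom}\varphi$ if on a neighborhood of $\bar x$ it is represented as $\varphi=\vartheta\circ f$ where $f\colon\mathbb{R}^n\to\mathbb{R}^m$ is twice differentiable at $\bar x$, $\vartheta\colon\mathbb{R}^m\to\overline{\mathbb{R}}$ is convex PWLQ, and the metric subregularity qualification condition (MSQC) holds: there are $\kappa\ge0$ and a neighborhood $U$ of $\bar x$ with $\operatorname{dist}(x;\Omega)\le\kappa\operatorname{dist}(f(x);\operatorname{dom}\vartheta)$ for all $x\in U$, where $\Omega:=\{x\mid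 f(x)\in\operatorname{dom}\vartheta\}$. Regular normal cone: $\widehat N_\Omega(\bar x):=\{v\mid\limsup_{x\to\bar x,\,x\in\Omega}\frac{\langle v,x-\bar x\rangle}{\|x-\bar x\|}\le 0\}$; limiting normal cone $N_\Omega(\bar x)$: all limits of $v_k\in\widehat N_\Omega(x_k)$ with $x_k\to\bar x$, $x_k\in\Omega$. Limiting subdifferential: $\partial\varphi(\bar x):=\{v\mid(v,-1)\in N_{\operatorname{epi}\varphi}(\bar x,\varphi(\bar x))\}$ (the usual subdifferential for convex functions). With $\Delta_t^2\varphi(\bar x,\bar v)(w):=\frac{\varphi(\bar x+tw)-\varphi(\bar x)-t\langle\bar v,w\rangle}{\frac12t^2}$, the second subderivative is $\mathrm{d}^2\varphi(\bar x,\bar v)(w):=\liminf_{t\downarrow0,\,u\to w}\Delta_t^2\varphi(\bar x,\bar v)(u)$. $\varphi$ is twice epi-differentiable at $\bar x$ for $\bar v$ if $\Delta_t^2\varphi(\bar x,\bar v)$ epi-converge to $\mathrm{d}^2\varphi(\bar x,\bar v)$ as $t\downarrow0$; equivalently, for every $w\in\mathbb{R}^n$ and every $t_k\downarrow0$ there is $w_k\to w$ with $\Delta_{t_k}^2\varphi(\bar x,\bar v)(w_k)\to\mathrm{d}^2\varphi(\bar x,\bar v)(w)$. It is properly twice epi-differentiable if in addition $\mathrm{d}^2\varphi(\bar x,\bar v)$ is proper (never $-\infty$ and with nonempty domain). The maximum may take the value $+\infty$. *)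

(* Defs.v *)
From HB Require Import structures.
From mathcomp Require Import all_boot all_order all_algebra.
From mathcomp Require Import all_classical all_reals all_analysis.
Import Order.TTheory GRing.Theory Num.Theory.
Import numFieldNormedType.Exports.

Set Implicit Arguments.
Unset Strict Implicit.
Unset Printing Implicit Defensive.

Local Open Scope classical_set_scope.
Local Open Scope ring_scope.

(* Vectors are rows, as for the library's Jacobian: the m x n matrix written
   nabla f(x) in the usual column convention is the transpose of 'J f x, so
   nabla f(x) w is w *m 'J f x and nabla f(x)^* lambda is
   lambda *m ('J f x)^T. *)

Section Euclidean.
Context {R : realType}.

Definition dotp n (u v : 'rV[R]_n) : R := \sum_(i < n) u ord0 i * v ord0 i.

(* The library norm on matrices is the sup norm; it induces the same topology,
   so neighbourhoods and limits are those of the library. *)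
Definition enorm n (u : 'rV[R]_n) : R := Num.sqrt (dotp u u).

(* dist (x; set0) = +oo *)
Definition dist n (x : 'rV[R]_n) (S : set 'rV[R]_n) : \bar R :=
  ereal_inf [set (enorm (x - y))%:E | y in S].

Definition polyhedral n (S : set 'rV[R]_n) : Prop :=
  exists (k : nat) (B : 'I_k -> 'rV[R]_n) (b : 'I_k -> R),
    S = [set y | forall j, dotp (B j) y <= b j].

End Euclidean.

Section ExtendedReal.
Context {R : realType}.

Definition edom n (phi : 'rV[R]_n -> \bar R) : set 'rV[R]_n :=
  [set x | (phi x < +oo)%E].

(* R^n x R is identified with R^(n+1), the last coordinate being the height. *)
Definition epair n (x : 'rV[R]_n) (alpha : R) : 'rV[R]_(n + 1) :=
  row_mx x (const_mx alpha).

Definition epi n (phi : 'rV[R]_n -> \bar R) : set 'rV[R]_(n + 1) :=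
  [set z | exists x alpha, z = epair x alpha /\ (phi x <= alpha%:E)%E].

(* Meant for functions that never take the value -oo. *)
Definition econvex n (phi : 'rV[R]_n -> \bar R) : Prop :=
  forall (x y : 'rV[R]_n) (t : R), 0 < t -> t < 1 ->
    (phi (t *: x + (1 - t) *: y)%R <= t%:E * phi x + (1 - t)%R%:E * phi y)%E.

Definition PWLQ m (theta : 'rV[R]_m -> \bar R) : Prop :=
  exists (s : nat) (Omega : 'I_s -> set 'rV[R]_m)
    (A : 'I_s -> 'M[R]_m) (a : 'I_s -> 'rV[R]_m) (alpha : 'I_s -> R),
    [/\ forall i, polyhedral (Omega i),
        forall i, (A i)^T = A i,
        edom theta = \bigcup_i Omega i
      & forall i y, Omega i y ->
          theta y
          = (2^-1 * dotp (y *m A i) y + dotp (a i) y + alpha i)%:E].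

End ExtendedReal.

Section Derivatives.
Context {R : realType}.

Definition twice_differentiable n m (f : 'rV[R]_n -> 'rV[R]_m)
    (x : 'rV[R]_n) : Prop :=
  (\forall y \near x, differentiable f y)
  /\ differentiable (fun y => 'J f y) x.

Definition gradient n (g : 'rV[R]_n -> R^o) (x : 'rV[R]_n) : 'rV[R]_n :=
  \row_j 'd g x (delta_mx ord0 j).

Definition hessian n (g : 'rV[R]_n -> R^o) (x : 'rV[R]_n) : 'M[R]_n :=
  'J (gradient g) x.

Definition second_derivative n m (f : 'rV[R]_n -> 'rV[R]_m)
    (x w v : 'rV[R]_n) : 'rV[R]_m :=
  \row_i dotp (w *m hessian (fun y => f y ord0 i) x) v.

End Derivatives.

Section Subdifferential.
Context {R : realType}.

(* The point xbar is excluded from the limsup. At an isolated point of Omega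
   the filter is improper, the limsup is -oo and the cone is the whole space. *)
Definition regular_normal_cone n (Omega : set 'rV[R]_n) (xbar : 'rV[R]_n) :
    set 'rV[R]_n :=
  [set v | (limf_esup
     (fun x : 'rV[R]_n => (dotp v (x - xbar) / enorm (x - xbar))%R%:E)
     (within Omega xbar^') <= 0)%E].

Definition limiting_normal_cone n (Omega : set 'rV[R]_n) (xbar : 'rV[R]_n) :
    set 'rV[R]_n :=
  [set v | exists xk vk : nat -> 'rV[R]_n,
    [/\ forall k, Omega (xk k),
        forall k, regular_normal_cone Omega (xk k) (vk k),
        xk @ \oo --> xbar
      & vk @ \oo --> v]].

Definition subdifferential n (phi : 'rV[R]_n -> \bar R) (xbar : 'rV[R]_n) :
    set 'rV[R]_n :=
  [set v | phi xbar \is a fin_num /\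
    limiting_normal_cone (epi phi) (epair xbar (fine (phi xbar)))
      (epair v (-1))].

End Subdifferential.

Section SecondSubderivative.
Context {R : realType}.

Definition second_quotient n (phi : 'rV[R]_n -> \bar R)
    (xbar vbar : 'rV[R]_n) (t : R) (w : 'rV[R]_n) : \bar R :=
  ((phi (xbar + t *: w)%R - phi xbar - (t * dotp vbar w)%R%:E)
   * ((2^-1 * t ^+ 2)^-1)%R%:E)%E.

Definition second_subderivative n (phi : 'rV[R]_n -> \bar R)
    (xbar vbar w : 'rV[R]_n) : \bar R :=
  limf_einf (fun p : R * 'rV[R]_n => second_quotient phi xbar vbar p.1 p.2)
    (filter_prod 0^'+ (nbhs w)).

Definition decreases_to0 (t : nat -> R) : Prop :=
  (forall k, 0 < t k) /\ t @ \oo --> 0.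

(* Painleve-Kuratowski limits of the sets C t as t decreases to 0 *)
Definition outer_limit n (C : R -> set 'rV[R]_n) : set 'rV[R]_n :=
  [set z | exists (t : nat -> R) (zk : nat -> 'rV[R]_n),
    [/\ decreases_to0 t, forall k, C (t k) (zk k) & zk @ \oo --> z]].

Definition inner_limit n (C : R -> set 'rV[R]_n) : set 'rV[R]_n :=
  [set z | forall t : nat -> R, decreases_to0 t ->
    exists zk : nat -> 'rV[R]_n,
      (\forall k \near \oo, C (t k) (zk k)) /\ zk @ \oo --> z].

Definition epi_converges n (D : R -> 'rV[R]_n -> \bar R)
    (g : 'rV[R]_n -> \bar R) : Prop :=
  outer_limit (fun t => epi (D t)) = epi g
  /\ inner_limit (fun t => epi (D t)) = epi g.

Definition twice_epi_differentiable n (phi : 'rV[R]_n -> \bar R)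
    (xbar vbar : 'rV[R]_n) : Prop :=
  epi_converges (second_quotient phi xbar vbar)
    (second_subderivative phi xbar vbar).

Definition proper n (g : 'rV[R]_n -> \bar R) : Prop :=
  (forall w, g w != -oo%E) /\ edom g !=set0.

Definition properly_twice_epi_differentiable n (phi : 'rV[R]_n -> \bar R)
    (xbar vbar : 'rV[R]_n) : Prop :=
  twice_epi_differentiable phi xbar vbar
  /\ proper (second_subderivative phi xbar vbar).

End SecondSubderivative.

Section Subamenable.
Context {R : realType}.

Definition MSQC n m (theta : 'rV[R]_m -> \bar R)
    (f : 'rV[R]_n -> 'rV[R]_m) (xbar : 'rV[R]_n) : Prop :=
  exists2 kappa : R, 0 <= kappa &
    \forall x \near xbar,
      (dist x (f @^-1` edom theta)
       <= kappa%:E * dist (f x) (edom theta))%E.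

(* phi is fully subamenable at xbar with local representation theta \o f *)
Definition fully_subamenable_with n m (phi : 'rV[R]_n -> \bar R)
    (xbar : 'rV[R]_n) (theta : 'rV[R]_m -> \bar R)
    (f : 'rV[R]_n -> 'rV[R]_m) : Prop :=
  [/\ \forall x \near xbar, phi x = theta (f x),
      twice_differentiable f xbar,
      forall y, theta y != -oo%E,
      econvex theta /\ PWLQ theta
    & MSQC theta f xbar].

Definition multipliers n m (theta : 'rV[R]_m -> \bar R)
    (f : 'rV[R]_n -> 'rV[R]_m) (xbar vbar : 'rV[R]_n) : set 'rV[R]_m :=
  [set lambda | lambda *m ('J f xbar)^T = vbar
     /\ subdifferential theta (f xbar) lambda].

(* The maximum is attained; it may be +oo. *)
Definition is_maximum (A : set (\bar R)) (y : \bar R) : Prop :=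
  A y /\ ubound A y.

End Subamenable.

(* Main.v *)
Require Import Defs.
From HB Require Import structures.
From mathcomp Require Import all_boot all_order all_algebra.
From mathcomp Require Import all_classical all_reals all_analysis.
From mathcomp Require Import ring lra.
Import Order.TTheory GRing.Theory Num.Theory.
Import numFieldNormedType.Exports.

(** Write [J] for the derivative of [f] at [xbar], [z] for its second
    derivative along [(w, w)], [a = w *m J] and [ybar = f xbar].

    The lower bound holds for each multiplier separately
    ([second_subderivative_comp_ge]): the expansion
    [f (xbar + t w') = ybar + t (w' *m J) + t^2 / 2 z + o(t^2)] turns a second
    difference quotient of [phi] into one of [theta] in a direction tending to
    [a], shifted by [dotp lambda z]. Moreover [theta] is rigid
    ([second_subderivative_dichotomy]): for a subgradient [lambda], either its
    second subderivative in the direction [a] is infinite, in which case nothing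
    remains to be shown, or [theta] is exactly quadratic on a short ray issued
    from [ybar] in the direction [a], with slope [dotp lambda a] and curvature
    [Q] at most the second subderivative.

    The converse needs one multiplier and, for every small step, one nearly
    optimal direction; both come from the same convex problem. Metric
    subregularity moves a point back into the feasible set at a cost
    proportional to its residual ([restoration]). Applied near [xbar], this
    shows that a subgradient [vbar] of [phi] satisfies, for some constant [C],
      [<vbar, u> <= theta y' - theta ybar + C * |u *m J - (y' - ybar)|]
    for all [u] and all [y'] in the domain of [theta]
    ([penalized_subgradient]). This inequality has no multipliers in it, hence
    passes to limits of regular normals without any bound on multipliers. It
    says that the convex function of [z] given by the infimum of
      [r + C * |u *m J + z - d| - <vbar, u>]
    over [u] and over [(d, r)] in the cone generated by
    [epi theta - (ybar, theta ybar)] vanishes at the origin. The penalty being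
    finite everywhere, Hahn-Banach gives strong duality
    ([penalized_duality]): for each [z] there is a multiplier [lambda] for which
    [dotp lambda z] equals this infimum.

    Finally, take [u] and [d = s *: (y' - ybar)] nearly optimal. The arc
    [xbar + t w + t^2 / 2 u] is mapped close to [ybar + t a + t^2 / 2 d], a point
    whose value is controlled by convexity and by the quadratic ray; the gap is
    of order [t^2 / 2 * |u *m J + z - d|], and restoring feasibility costs [C]
    times the gap ([parabolic_recovery]). The resulting quotients are at most
    [Q + dotp lambda z] up to an arbitrarily small error. Together with the
    lower bound this gives the formula, the attainment of the maximum, and, as
    such points exist for every small step, epi-convergence
    ([epi_converges_liminf]). *)

Set Implicit Arguments.
Unset Strict Implicit.
Unset Printing Implicit Defensive.

Local Open Scope classical_set_scope.
Local Open Scope ring_scope.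

(** * Bounds in the sup norm *)

Section Bounds.
Context {R : realType}.

Lemma dotp_mx n (u v : 'rV[R]_n) : dotp u v = (u *m v^T) ord0 ord0.
Proof. by rewrite mxE; apply: eq_bigr => i _; rewrite mxE. Qed.

Lemma dotpDl n (u v w : 'rV[R]_n) : dotp (u + v) w = dotp u w + dotp v w.
Proof. by rewrite !dotp_mx mulmxDl mxE. Qed.

Lemma dotpDr n (u v w : 'rV[R]_n) : dotp w (u + v) = dotp w u + dotp w v.
Proof. by rewrite !dotp_mx raddfD mulmxDr mxE. Qed.

Lemma dotpNl n (u w : 'rV[R]_n) : dotp (- u) w = - dotp u w.
Proof. by rewrite !dotp_mx mulNmx mxE. Qed.

Lemma dotpNr n (u w : 'rV[R]_n) : dotp w (- u) = - dotp w u.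
Proof. by rewrite !dotp_mx raddfN mulmxN mxE. Qed.

Lemma dotpBl n (u v w : 'rV[R]_n) : dotp (u - v) w = dotp u w - dotp v w.
Proof. by rewrite dotpDl dotpNl. Qed.

Lemma dotpBr n (u v w : 'rV[R]_n) : dotp w (u - v) = dotp w u - dotp w v.
Proof. by rewrite dotpDr dotpNr. Qed.

Lemma dotpZl n k (u w : 'rV[R]_n) : dotp (k *: u) w = k * dotp u w.
Proof. by rewrite !dotp_mx -scalemxAl mxE. Qed.

Lemma dotpZr n k (u w : 'rV[R]_n) : dotp w (k *: u) = k * dotp w u.
Proof. by rewrite !dotp_mx linearZ /= -scalemxAr mxE. Qed.

Lemma dotp0r n (w : 'rV[R]_n) : dotp w 0 = 0.
Proof. by rewrite dotp_mx trmx0 mulmx0 mxE. Qed.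

Lemma dotp_mulmx n m (u : 'rV[R]_n) (A : 'M[R]_(n, m)) v :
  dotp (u *m A) v = dotp u (v *m A^T).
Proof. by rewrite !dotp_mx trmx_mul trmxK mulmxA. Qed.

Lemma dotp_delta n (u : 'rV[R]_n) j : dotp u (delta_mx ord0 j) = u ord0 j.
Proof.
rewrite /dotp (bigD1 j) //= mxE !eqxx mulr1 big1 ?addr0 // => i ij.
by rewrite mxE (negbTE ij) andbF mulr0.
Qed.

Lemma mx_coord_le m n (A : 'M[R]_(m, n)) i j : `|A i j| <= `|A|.
Proof.
rewrite {2}/Num.norm/= mx_normrE; apply/bigmax_geP; right => /=.
by exists (i, j).
Qed.

Lemma mx_norm_le m n (A : 'M[R]_(m, n)) c :
  0 <= c -> (forall i j, `|A i j| <= c) -> `|A| <= c.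
Proof.
move=> c0 Ac; rewrite /Num.norm/= mx_normrE.
by apply/bigmax_leP; split=> // -[i j] _ /=.
Qed.

Lemma mulmx_norm_le n m (u : 'rV[R]_n) (A : 'M[R]_(n, m)) :
  `|u *m A| <= n%:R * `|A| * `|u|.
Proof.
apply: mx_norm_le => [|i j]; first by rewrite !mulr_ge0.
rewrite mxE (le_trans (ler_norm_sum _ _ _)) //.
have -> : n%:R * `|A| * `|u| = \sum_(k < n) `|u| * `|A|.
  by rewrite sumr_const card_ord -mulr_natl; ring.
by apply: ler_sum => k _; rewrite normrM ler_pM // mx_coord_le.
Qed.

Lemma dotp_norm_le n (u v : 'rV[R]_n) : `|dotp u v| <= n%:R * `|u| * `|v|.
Proof.
rewrite /dotp (le_trans (ler_norm_sum _ _ _)) //.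
have -> : n%:R * `|u| * `|v| = \sum_(k < n) `|u| * `|v|.
  by rewrite sumr_const card_ord -mulr_natl; ring.
by apply: ler_sum => k _; rewrite normrM ler_pM // mx_coord_le.
Qed.

Lemma dotp_ge n (u v : 'rV[R]_n) : - (n%:R * `|u| * `|v|) <= dotp u v.
Proof. by have := dotp_norm_le u v; rewrite ler_norml => /andP[]. Qed.

Lemma dotp_le n (u v : 'rV[R]_n) : dotp u v <= n%:R * `|u| * `|v|.
Proof. by have := dotp_norm_le u v; rewrite ler_norml => /andP[]. Qed.

Lemma norm_le_enorm n (u : 'rV[R]_n) : `|u| <= enorm u.
Proof.
apply: mx_norm_le => [|i j]; first exact: sqrtr_ge0.
rewrite ord1 -sqrtr_sqr ler_wsqrtr // /dotp (bigD1 j) //= expr2 lerDl.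
by apply: sumr_ge0 => k _; rewrite -expr2 sqr_ge0.
Qed.

Lemma enorm_le_norm n (u : 'rV[R]_n) : enorm u <= n%:R * `|u|.
Proof.
rewrite /enorm -[leRHS](@ger0_norm _ (n%:R * `|u|)) ?mulr_ge0 //.
rewrite -sqrtr_sqr ler_wsqrtr // (le_trans (dotp_le u u)) //.
case: n u => [|n] u; first by rewrite !mul0r expr2 mul0r.
rewrite exprMn expr2 -!mulrA; apply: ler_wpM2l => //.
by rewrite ler_peMl ?mulr_ge0 // ler1n.
Qed.

Lemma cvg_dotp T (F : set_system T) n (u v : T -> 'rV[R]_n)
    (a b : 'rV[R]_n) :
  Filter F -> u @ F --> a -> v @ F --> b ->
  (fun x => dotp (u x) (v x)) @ F --> dotp a b.
Proof.
move=> FF ua vb; apply: cvg_big => [|i _]; first exact: add_continuous.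
apply: cvgM.
  exact: (cvg_comp u _ ua (@coord_continuous _ _ _ ord0 i _)).
exact: (cvg_comp v _ vb (@coord_continuous _ _ _ ord0 i _)).
Qed.

Lemma cvg_dotpr T (F : set_system T) n (a : 'rV[R]_n) (v : T -> 'rV[R]_n)
    (b : 'rV[R]_n) :
  Filter F -> v @ F --> b -> (fun x => dotp a (v x)) @ F --> dotp a b.
Proof. by move=> FF vb; apply: (cvg_dotp (u := fun=> a)) => //; exact: cvg_cst. Qed.

Lemma continuous_dotp n (a b : 'rV[R]_n) :
  dotp a y @[y --> b] --> dotp a b.
Proof. exact: (@cvg_dotpr _ (nbhs b) _ a id). Qed.

Lemma cvg_mulmx T (F : set_system T) n m (u : T -> 'rV[R]_n)
    (A : 'M[R]_(n, m)) (a : 'rV[R]_n) :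
  Filter F -> u @ F --> a -> (fun x => u x *m A) @ F --> a *m A.
Proof.
move=> FF ua.
apply/cvgrPdist_le => e e0.
have k0 : 0 < n%:R * `|A| + 1 by rewrite ltr_wpDl // mulr_ge0.
have /cvgrPdist_le /(_ (e / (n%:R * `|A| + 1))) := ua.
rewrite divr_gt0 // => /(_ isT); apply: filterS => x xa.
rewrite -mulmxBl (le_trans (mulmx_norm_le _ _)) //.
rewrite ler_pdivlMr // in xa; apply: le_trans xa.
by rewrite mulrC ler_wpM2l // lerDl.
Qed.

Lemma cvg_mulmxr T (F : set_system T) n m (u : 'rV[R]_n)
    (A : T -> 'M[R]_(n, m)) (B : 'M[R]_(n, m)) :
  Filter F -> A @ F --> B -> (fun x => u *m A x) @ F --> u *m B.
Proof.
move=> FF AB.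
apply/cvgrPdist_le => e e0.
have k0 : 0 < n%:R * `|u| + 1 by rewrite ltr_wpDl // mulr_ge0.
have /cvgrPdist_le /(_ (e / (n%:R * `|u| + 1))) := AB.
rewrite divr_gt0 // => /(_ isT); apply: filterS => x xa.
rewrite -mulmxBr (le_trans (mulmx_norm_le _ _)) // mulrAC.
rewrite ler_pdivlMr // in xa; apply: le_trans xa.
by rewrite mulrC ler_wpM2l // lerDl.
Qed.

Lemma near_in_ball n (a c : 'rV[R]_n) r :
  `|a - c| < r -> \forall y \near a, `|y - c| < r.
Proof.
move=> ar; apply/nbhs_normP; exists (r - `|a - c|); first by rewrite /= subr_gt0.
move=> y; rewrite /ball_ /= ltrBrDr distrC; apply: le_lt_trans.
by rewrite -[y - c](subrKA a) ler_normD.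
Qed.

End Bounds.

Arguments continuous_dotp {R n} a b.

(** * A finite-dimensional sandwich theorem *)

Section Sandwich.
Context {R : realType}.

Definition sublinear m (p : 'rV[R]_m -> R) : Prop :=
  (forall x y, p (x + y) <= p x + p y) /\
  (forall s x, 0 < s -> p (s *: x) <= s * p x).

Definition convex_cone m (S : set ('rV[R]_m * R)) : Prop :=
  [/\ S (0, 0),
      forall u v, S u -> S v -> S (u.1 + v.1, u.2 + v.2)
    & forall s u, 0 < s -> S u -> S (s *: u.1, s * u.2)].

Lemma sublinear0 m (p : 'rV[R]_m -> R) : sublinear p -> p 0 = 0.
Proof.
case=> pD pZ; have := pD 0 0; have := pZ 2^-1 0; rewrite addr0 scaler0.
by rewrite invr_gt0 ltr0n => /(_ isT); lra.
Qed.

(** The infimal convolution of [p] with the cone. The last inequality forces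
    every linear minorant of the new function to lie above the cone. *)
Lemma sublinear_tighten m (p : 'rV[R]_m -> R) (S : set ('rV[R]_m * R)) :
  sublinear p -> convex_cone S -> (forall u, S u -> u.2 <= p u.1) ->
  exists P, [/\ sublinear P, forall x, P x <= p x
              & forall u, S u -> P (- u.1) <= - u.2].
Proof.
move=> psub [S0 SD SZ] Sp; have [pD pZ] := psub.
pose E (x : 'rV[R]_m) := [set p (x + u.1) - u.2 | u in S].
have E0 x : E x !=set0 by exists (p (x + 0) - 0), (0, 0).
have Elb x : has_lbound (E x).
  exists (- p (- x)) => _ [u Su <-].
  have := pD (x + u.1) (- x); rewrite (addrC x) addrK.
  have := Sp _ Su; lra.
pose P (x : 'rV[R]_m) := inf (E x).
have P_le x u : S u -> P x <= p (x + u.1) - u.2.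
  by move=> Su; apply: ge_inf => //; exists u.
have le_P x c : (forall u, S u -> c <= p (x + u.1) - u.2) -> c <= P x.
  by move=> cle; apply: lb_le_inf => // _ [u Su <-]; exact: cle.
exists P; split.
- split=> [x y|s x s0].
    rewrite -lerBlDr; apply: (le_P x) => u Su.
    rewrite lerBlDr -lerBlDl; apply: (le_P y) => v Sv.
    have := P_le (x + y) _ (SD _ _ Su Sv) => /=.
    have -> : x + y + (u.1 + v.1) = (x + u.1) + (y + v.1) by rewrite addrACA.
    have := pD (x + u.1) (y + v.1); lra.
  rewrite -ler_pdivrMl //; apply: (le_P x) => u Su.
  rewrite ler_pdivrMl //; apply: le_trans (P_le _ _ (SZ _ _ s0 Su)) _ => /=.
  by rewrite -scalerDr mulrBr lerB // pZ.
- by move=> x; have := P_le x _ S0; rewrite addr0 subr0.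
- move=> u Su; have := P_le (- u.1) _ Su; rewrite addNr.
  by rewrite sublinear0 // sub0r.
Qed.

(** Tightening along the coordinate axes one after the other makes the function
    odd on the basis vectors, whose values then define a linear form. *)
Lemma sublinear_minorant m (p : 'rV[R]_m -> R) :
  sublinear p -> exists lambda, forall x, dotp lambda x <= p x.
Proof.
move=> psub; pose e (i : 'I_m) : 'rV[R]_m := delta_mx ord0 i.
have [P [Psub Pp Podd]] : exists P, [/\ sublinear P, forall x, P x <= p x
    & forall i, P (e i) + P (- e i) <= 0].
  suff /(_ m (leqnn m))[P [Psub Pp Podd]] : forall k, (k <= m)%N ->
      exists P, [/\ sublinear P, forall x, P x <= p x
      & forall i : 'I_m, (i < k)%N -> P (e i) + P (- e i) <= 0].
    by exists P; split=> // i; exact: Podd.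
  elim=> [_|k IH km]; first by exists p; split.
  have [P [Psub Pp Podd]] := IH (ltnW km).
  pose i0 : 'I_m := Ordinal km.
  pose S := [set (s *: e i0, s * P (e i0)) | s in [set s | 0 <= s]].
  have Scone : convex_cone S.
    split=> [|_ _ [s s0 <-] [t t0 <-]|s _ s0 [t t0 <-]] /=.
    - by exists 0 => //=; rewrite scale0r mul0r.
    - by exists (s + t); rewrite /= ?addr_ge0 // scalerDl mulrDl.
    - by exists (s * t); rewrite /= ?mulr_ge0 // 1?ltW // scalerA mulrA.
  have SP u : S u -> u.2 <= P u.1.
    move=> [s /= s0 <-] /=.
    have [->|sN0] := eqVneq s 0; first by rewrite mul0r scale0r sublinear0.
    have sgt0 : 0 < s by rewrite lt_def sN0.
    have [_ PZ] := Psub; have := PZ s^-1 (s *: e i0).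
    by rewrite invr_gt0 sgt0 scalerA mulVf // scale1r ler_pdivlMl // => ->.
  have [Q [Qsub QP QS]] := sublinear_tighten Psub Scone SP.
  exists Q; split=> // [x|i]; first exact: le_trans (QP x) (Pp x).
  rewrite ltnS leq_eqVlt => /predU1P[ik|ik]; last first.
    by have := Podd i ik; have := QP (e i); have := QP (- e i); lra.
  have -> : i = i0 by apply/val_inj.
  have /QS /= : S (1 *: e i0, 1 * P (e i0)) by exists 1 => /=.
  by rewrite scale1r mul1r; have := QP (e i0); lra.
exists (\row_i P (e i)) => x; apply: le_trans (Pp x).
have [PD PZ] := Psub.
have Px : 0 <= P x + P (- x) by have := PD x (- x); rewrite subrr sublinear0.
suff : P (- x) <= - dotp (\row_i P (e i)) x by lra.
have sum_le (F : 'I_m -> 'rV[R]_m) : P (\sum_i F i) <= \sum_i P (F i).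
  elim/big_rec2: _ => [|i y1 y2 _ le]; first by rewrite sublinear0.
  by apply: le_trans (PD _ _) _; rewrite lerD2l.
rewrite {1}[x]row_sum_delta -sumrN; apply: le_trans (sum_le _) _.
rewrite /dotp -sumrN; apply: ler_sum => i _; rewrite mxE -/(e i).
have := Podd i; set xi := x _ _ => Poddi.
have [xi0|xi0|->] := ltgtP xi 0.
- have := PZ (- xi) (e i); rewrite oppr_gt0 => /(_ xi0).
  by rewrite scaleNr; lra.
- have := PZ xi (- e i) xi0; rewrite scalerN.
  by have : xi * (P (e i) + P (- e i)) <= 0; [exact: mulr_ge0_le0 (ltW xi0) _|lra].
- by rewrite scale0r oppr0 sublinear0 // mulr0 oppr0.
Qed.

Lemma sandwich m (p : 'rV[R]_m -> R) (S : set ('rV[R]_m * R)) :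
  sublinear p -> convex_cone S -> (forall u, S u -> u.2 <= p u.1) ->
  exists lambda, (forall x, dotp lambda x <= p x) /\
                 (forall u, S u -> u.2 <= dotp lambda u.1).
Proof.
move=> psub Scone Sp.
have [P [Psub Pp PS]] := sublinear_tighten psub Scone Sp.
have [lambda lamP] := sublinear_minorant Psub.
exists lambda; split=> [x|u Su]; first exact: le_trans (lamP x) (Pp x).
by have := lamP (- u.1); have := PS _ Su; rewrite dotpNr; lra.
Qed.

(** With [beta] the infimum attached to [z], the cone [S] records both the
    penalized inequality and the value [beta] in the direction [z]; it lies below
    the penalty, and a separating linear form is the required multiplier. *)
Lemma penalized_duality n m (G : set ('rV[R]_m * R)) (C : R)
    (J : 'M[R]_(n, m)) (v : 'rV[R]_n) (z : 'rV[R]_m) :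
  0 <= C -> convex_cone G ->
  (forall u g, G g -> dotp v u <= g.2 + C * `|u *m J - g.1|) ->
  exists lambda, [/\ lambda *m J^T = v,
    forall g, G g -> dotp lambda g.1 <= g.2
    & forall e, 0 < e -> exists u g, G g /\
        g.2 + C * `|u *m J + z - g.1| - dotp v u < dotp lambda z + e].
Proof.
move=> C0 [G0 GD GZ] vle.
pose E := [set x | exists u g, G g /\
  x = g.2 + C * `|u *m J + z - g.1| - dotp v u].
have E0 : E !=set0 by exists (0 + C * `|0 *m J + z - 0| - dotp v 0), 0, (0, 0).
have Elb : has_lbound E.
  exists (- (C * `|z|)) => _ [u [g [Gg ->]]].
  have := vle u _ Gg.
  have : C * `|u *m J - g.1| <= C * `|u *m J + z - g.1| + C * `|z|.
    rewrite -mulrDr ler_wpM2l //.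
    have -> : u *m J - g.1 = (u *m J + z - g.1) - z.
      by rewrite [_ + z - _]addrAC addrK.
    exact: ler_normB.
  lra.
pose beta := inf E.
pose S := [set x | exists u s g, [/\ 0 <= s, G g,
  x.1 = u *m J + s *: z - g.1 & x.2 = dotp v u + s * beta - g.2]].
have psub : sublinear (fun x : 'rV[R]_m => C * `|x|).
  split=> [x y|s x s0]; first by rewrite -mulrDr ler_wpM2l // ler_normD.
  by rewrite normrZ gtr0_norm // mulrCA.
have Scone : convex_cone S.
  split=> [|[x1 x2] [y1 y2]|s [x1 x2] s0].
  - by exists 0, 0, (0, 0); split=> //=;
      rewrite ?mul0mx ?scale0r ?dotp0r ?mul0r !addr0 ?subr0 ?oppr0.
  - move=> [u [s [g [s0 Gg /= -> ->]]]] [u' [s' [g' [s0' Gg' /= -> ->]]]].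
    exists (u + u'), (s + s'), (g.1 + g'.1, g.2 + g'.2).
    split; [exact: addr_ge0|exact: GD|rewrite /=|rewrite /= dotpDr; ring].
    by rewrite mulmxDl; apply/rowP => i; rewrite !mxE; ring.
  - move=> [u [s' [g [s0' Gg /= -> ->]]]].
    exists (s *: u), (s * s'), (s *: g.1, s * g.2).
    split; [by rewrite mulr_ge0 // ltW|exact: GZ| |rewrite /= dotpZr; ring].
    by rewrite /= -scalemxAl -scalerA -scalerDr -scalerBr.
have Sp x : S x -> x.2 <= C * `|x.1|.
  move: x => [x1 x2] [u [s [g [s0 Gg /= -> ->]]]].
  move: s0; rewrite le_eqVlt => /predU1P[<-|s0].
    by rewrite scale0r mul0r !addr0 lerBlDr addrC; exact: vle.
  have si0 : 0 < s^-1 by rewrite invr_gt0.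
  have : beta <= s^-1 * g.2 + C * `|(s^-1 *: u) *m J + z - s^-1 *: g.1|
                 - dotp v (s^-1 *: u).
    by apply: ge_inf => //; exists (s^-1 *: u), (s^-1 *: g.1, s^-1 * g.2);
      split=> //; exact: GZ.
  have -> : (s^-1 *: u) *m J + z - s^-1 *: g.1 =
            s^-1 *: (u *m J + s *: z - g.1).
    rewrite scalerBr scalerDr -scalemxAl scalerA mulVf ?scale1r //.
    by rewrite gt_eqF.
  rewrite normrZ gtr0_norm // dotpZr mulrCA -mulrDr -mulrBr ler_pdivlMl //.
  lra.
have [lambda [lamC lamS]] := sandwich psub Scone Sp.
exists lambda; split.
- have le u : dotp v u <= dotp lambda (u *m J).
    have /lamS /= : S (u *m J, dotp v u).
      by exists u, 0, (0, 0); split=> //=;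
        rewrite ?scale0r ?mul0r !addr0 ?subr0 ?oppr0.
    by [].
  have eq u : dotp v u = dotp lambda (u *m J).
    apply/eqP; rewrite eq_le le /=; have := le (- u).
    by rewrite mulNmx !dotpNr lerN2.
  by apply/rowP => j; rewrite -!dotp_delta eq dotp_mulmx trmxK.
- move=> g Gg; have /lamS /= : S (- g.1, - g.2).
    by exists 0, 0, g; split=> //=;
      rewrite ?mul0mx ?scale0r ?dotp0r ?mul0r !add0r.
  by rewrite dotpNr lerN2.
- move=> e e0; have [x [u [g [Gg ->]]] xlt] := inf_adherent e0 (conj E0 Elb).
  exists u, g; split=> //; apply: lt_le_trans xlt _; rewrite lerD2r.
  have /lamS /= : S (z, beta).
    by exists 0, 1, (0, 0); split=> //=;
      rewrite ?mul0mx ?scale1r ?dotp0r ?mul1r !add0r ?subr0 ?oppr0 ?addr0.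
  by [].
Qed.

End Sandwich.

(** * Lower limits, normals and epi-convergence *)

Section LowerLimits.
Context {R : realType}.

Lemma limf_einf_ge (T : choiceType) (X : filteredType T) (f : X -> \bar R)
    (F : set_system X) (c : \bar R) :
  (\forall p \near F, c <= f p)%E -> (c <= limf_einf f F)%E.
Proof.
move=> cf; rewrite limf_einfE; apply: le_ereal_sup_tmp.
exists (ereal_inf (f @` [set p | c <= f p]%E)); first by exists [set p | c <= f p]%E.
by apply: le_ereal_inf_tmp => _ [p cp <-].
Qed.

Lemma limf_einf_gt (T : choiceType) (X : filteredType T) (f : X -> \bar R)
    (F : set_system X) {FF : Filter F} (c : \bar R) :
  (c < limf_einf f F)%E -> (\forall p \near F, c <= f p)%E.
Proof.
rewrite limf_einfE => /ereal_sup_gt[_ [A FA <-] cA].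
apply: filterS FA => p Ap; apply: le_trans (ltW cA) _.
by apply: ereal_inf_lbound; exists p.
Qed.

Lemma limf_einf_le (T : choiceType) (X : filteredType T) (f : X -> \bar R)
    (F : set_system X) (c : \bar R) :
  (forall A, F A -> exists2 p, A p & (f p <= c)%E) -> (limf_einf f F <= c)%E.
Proof.
move=> fc; rewrite limf_einfE; apply: ge_ereal_sup => _ [A FA <-].
have [p Ap fpc] := fc A FA; apply: le_trans fpc.
by apply: ereal_inf_lbound; exists p.
Qed.

Lemma epairK n (z : 'rV[R]_(n + 1)) :
  epair (lsubmx z) (rsubmx z ord0 ord0) = z.
Proof.
rewrite -[RHS]hsubmxK /epair; congr row_mx; apply/rowP => i.
by rewrite (ord1 i) !mxE; congr (z _ _); exact: val_inj.
Qed.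

Lemma lsubmx_epair n (x : 'rV[R]_n) a : lsubmx (epair x a) = x.
Proof. by rewrite row_mxKl. Qed.

Lemma rsubmx_epair n (x : 'rV[R]_n) a : rsubmx (epair x a) ord0 ord0 = a.
Proof. by rewrite row_mxKr mxE. Qed.

Lemma epairB n (x y : 'rV[R]_n) a b :
  epair x a - epair y b = epair (x - y) (a - b).
Proof.
rewrite /epair opp_row_mx add_row_mx; congr row_mx.
by apply/rowP => i; rewrite !mxE.
Qed.

Lemma epairD n (x y : 'rV[R]_n) a b :
  epair x a + epair y b = epair (x + y) (a + b).
Proof.
rewrite /epair add_row_mx; congr row_mx.
by apply/rowP => i; rewrite !mxE.
Qed.

Lemma epairZ n (x : 'rV[R]_n) a s : s *: epair x a = epair (s *: x) (s * a).
Proof.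
rewrite /epair scale_row_mx; congr row_mx.
by apply/rowP => i; rewrite !mxE.
Qed.

Lemma dotp_epair n (x y : 'rV[R]_n) a b :
  dotp (epair x a) (epair y b) = dotp x y + a * b.
Proof.
rewrite /dotp big_split_ord /= big_ord1 !row_mxEr !mxE; congr (_ + _).
by apply: eq_bigr => i _; rewrite !row_mxEl.
Qed.

Lemma norm_epair n (x : 'rV[R]_n) a : `|epair x a| <= `|x| + `|a|.
Proof.
apply: mx_norm_le => [|i j]; first exact: addr_ge0.
rewrite mxE; case: splitP => k _.
  by rewrite (le_trans (mx_coord_le _ _ _)) // lerDl.
by rewrite mxE lerDr.
Qed.

Lemma cvg_epair n (x : nat -> 'rV[R]_n) (a : nat -> R) (y : 'rV[R]_n) b :
  x @ \oo --> y -> a @ \oo --> b ->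
  (fun k => epair (x k) (a k)) @ \oo --> epair y b.
Proof.
move=> /cvgrPdist_le xy /cvgrPdist_le ab; apply/cvgrPdist_le => e e0.
have e2 : 0 < e / 2 by rewrite divr_gt0.
near=> k; rewrite epairB (le_trans (norm_epair _ _)) // [e]splitr lerD //.
  by near: k; exact: xy.
by near: k; exact: ab.
Unshelve. all: by end_near. Qed.

Lemma norm_lsubmx n (z : 'rV[R]_(n + 1)) : `|lsubmx z| <= `|z|.
Proof.
apply: mx_norm_le => // i j; rewrite mxE; exact: mx_coord_le.
Qed.

Lemma cvg_lsubmx n (z : nat -> 'rV[R]_(n + 1)) (a : 'rV[R]_(n + 1)) :
  z @ \oo --> a -> (fun k => lsubmx (z k)) @ \oo --> lsubmx a.
Proof.
move=> /cvgrPdist_le za; apply/cvgrPdist_le => e /za; apply: filterS => k.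
by apply: le_trans; rewrite -raddfB norm_lsubmx.
Qed.

Lemma cvg_rsubmx n (z : nat -> 'rV[R]_(n + 1)) (a : 'rV[R]_(n + 1)) :
  z @ \oo --> a ->
  (fun k => rsubmx (z k) ord0 ord0) @ \oo --> rsubmx a ord0 ord0.
Proof.
move=> /cvgrPdist_le za; apply/cvgrPdist_le => e /za; apply: filterS => k.
apply: le_trans; rewrite !mxE.
by have := mx_coord_le (a - z k) ord0 (rshift n ord0); rewrite !mxE.
Qed.

End LowerLimits.

Section Normals.
Context {R : realType}.

Lemma regular_normal_near n (Omega : set 'rV[R]_n) x v e :
  0 < e -> regular_normal_cone Omega x v ->
  \forall x' \near x, Omega x' -> dotp v (x' - x) <= e * `|x' - x|.
Proof.
move=> e0; have k0 : 0 < e / n.+1%:R by rewrite divr_gt0.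
rewrite /regular_normal_cone /= => vN.
have : (limf_esup (fun x' : 'rV[R]_n =>
    (dotp v (x' - x) / enorm (x' - x))%R%:E) (within Omega x^')
    < (e / n.+1%:R)%:E)%E by apply: le_lt_trans vN _; rewrite lte_fin.
rewrite limf_esupE => /ereal_inf_lt[_ [A FA <-] Alt].
have {}FA : \forall x' \near x, x' != x -> Omega x' -> A x' := FA.
apply: filterS FA => x' Ax' Ox'.
have [->|xx'] := eqVneq x' x; first by rewrite subrr dotp0r normr0 mulr0.
have en0 : 0 < enorm (x' - x).
  by apply: lt_le_trans (norm_le_enorm _); rewrite normr_gt0 subr_eq0.
have : ((dotp v (x' - x) / enorm (x' - x))%R%:E < (e / n.+1%:R)%:E)%E.
  apply: le_lt_trans Alt; apply: ereal_sup_ubound.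
  by exists x' => //; exact: Ax'.
rewrite lte_fin => /ltW; rewrite ler_pdivrMr // => /le_trans; apply.
apply: le_trans (ler_wpM2l (ltW k0) (enorm_le_norm _)) _.
rewrite mulrA ler_wpM2r // mulrAC ler_pdivrMr // ler_wpM2l ?ler_nat //.
exact: ltW.
Qed.

Lemma regular_normal_of_le0 n (Omega : set 'rV[R]_n) x v :
  (forall x', Omega x' -> dotp v (x' - x) <= 0) ->
  regular_normal_cone Omega x v.
Proof.
move=> vle; rewrite /regular_normal_cone /= limf_esupE.
apply: ge_ereal_inf; exists (ereal_sup [set
  (dotp v (x' - x) / enorm (x' - x))%R%:E | x' in Omega]).
  exists Omega => //.
  by apply: (@filterS _ (nbhs x) _ setT); [move=> x' _ _|exact: filterT].
apply: ge_ereal_sup => _ [x' Ox' <-]; rewrite lee_fin.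
by apply: mulr_le0_ge0; [exact: vle|rewrite invr_ge0 sqrtr_ge0].
Qed.

(** Along a segment issued from the base point the error term of a regular
    normal is negligible, so the inequality holds exactly. *)
Lemma regular_normal_segment n (Omega : set 'rV[R]_n) x v d :
  regular_normal_cone Omega x v ->
  (forall t, 0 < t -> t < 1 -> Omega (x + t *: d)) -> dotp v d <= 0.
Proof.
move=> vN xd; apply/ler_addgt0Pr => e e0; rewrite add0r.
have d0 : 0 < `|d| + 1 by rewrite ltr_wpDl.
have k0 : 0 < e / (`|d| + 1) by rewrite divr_gt0.
have := regular_normal_near k0 vN.
move=> /nbhs_normP[r /= r0 xr].
pose t := Num.min (2^-1) (r / 2 / (`|d| + 1)).
have t0 : 0 < t by rewrite lt_min invr_gt0 ltr0n !divr_gt0.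
have t1 : t < 1 by rewrite gt_min; apply/orP; left; lra.
have td : t * `|d| < r.
  have : t <= r / 2 / (`|d| + 1) by rewrite ge_min lexx orbT.
  by rewrite ler_pdivlMr // mulrDr mulr1; have := ltW t0; lra.
have /xr/(_ (xd _ t0 t1)) : ball_ Num.norm x r (x + t *: d).
  by rewrite /ball_ /= opprD addNKr normrN normrZ gtr0_norm.
rewrite (addrC x) addrK dotpZr normrZ gtr0_norm // mulrCA ler_pM2l //.
move/le_trans; apply; rewrite mulrAC ler_pdivrMr // ler_wpM2l ?lerDl //.
exact: ltW.
Qed.

End Normals.

Section EpiConvergence.
Context {R : realType}.

(** The radius at time [k] is given by the largest [j <= k] for which the
    property already holds at [1 / j.+1]. *)
Lemma diagonal_radius (P : nat -> R -> Prop) :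
  (forall e, 0 < e -> \forall k \near \oo, P k e) ->
  exists r : nat -> R, [/\ forall k, 0 < r k, r @ \oo --> 0
                        & \forall k \near \oo, P k (r k)].
Proof.
move=> Pe; pose Q k j := `[< P k j.+1%:R^-1 >].
pose j k := \max_(i < k.+1 | Q k i) i.
have j_ge k i : (i <= k)%N -> Q k i -> (i <= j k)%N.
  by rewrite -ltnS => ik Qi; exact: (leq_bigmax_cond (Ordinal ik)).
have jP k : Q k 0%N -> Q k (j k).
  move=> Q0; have [i Qi ->] : {i : 'I_k.+1 | Q k i & j k = i}.
    by apply: eq_bigmax_cond; apply/card_gt0P; exists ord0.
  exact: Qi.
exists (fun k => (j k).+1%:R^-1); split.
- by move=> k; rewrite invr_gt0.
- apply/cvgrPdist_le => e e0.
  have [N _ /(_ N (leqnn N)) /= Ne] := near_infty_natSinv_lt (PosNum e0).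
  have N0 : 0 < (N.+1%:R : R)^-1 by rewrite invr_gt0.
  have e1 : 0 < (1%:R : R)^-1 by rewrite invr_gt0.
  near=> k; rewrite sub0r normrN gtr0_norm ?invr_gt0 //.
  apply: le_trans (ltW Ne); rewrite lef_pV2 ?posrE // ler_nat ltnS.
  apply: j_ge; first by near: k; exact: nbhs_infty_ge.
  by apply/asboolP; near: k; exact: Pe.
- have e1 : 0 < (1%:R : R)^-1 by rewrite invr_gt0.
  apply: filterS (Pe _ e1) => k Pk.
  by apply/asboolP; apply: jP; apply/asboolP.
Unshelve. all: by end_near. Qed.

Lemma decreases_to0_inv : decreases_to0 (fun k => k.+1%:R^-1 : R).
Proof.
split=> [k|]; first by rewrite invr_gt0.
apply/cvgrPdist_le => e e0.
apply: filterS (near_infty_natSinv_lt (PosNum e0)) => k /= /ltW.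
by rewrite sub0r normrN gtr0_norm // invr_gt0.
Qed.

Lemma decreases_to0_at_right (t : nat -> R) :
  decreases_to0 t -> t @ \oo --> 0^'+.
Proof.
move=> [t0 tl] A; rewrite /at_right /within /= => A0.
have := tl _ A0; rewrite /nbhs /=; apply: filterS => k.
by apply; rewrite /=.
Qed.

Lemma limf_einf_recovery n (D : R -> 'rV[R]_n -> \bar R) (w : 'rV[R]_n)
    (b : R) :
  (forall e, 0 < e -> \forall t \near 0^'+,
     exists w', `|w' - w| < e /\ (D t w' <= (b + e)%:E)%E) ->
  (limf_einf (fun p : R * 'rV[R]_n => D p.1 p.2)
     (filter_prod 0^'+ (nbhs w)) <= b%:E)%E.
Proof.
move=> recov; apply/lee_addgt0Pr => e e0; rewrite -EFinD.
apply: limf_einf_le => P [[A B] /= [A0 /nbhs_normP[rho rho0 Brho]] ABP].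
have d0 : 0 < Num.min e rho by rewrite lt_min e0.
have [t [At [w' [w'w Dw']]]] : exists t, A t /\ exists w',
    `|w' - w| < Num.min e rho /\ (D t w' <= (b + Num.min e rho)%:E)%E.
  near (0 : R)^'+ => t; exists t; split; first by near: t.
  by near: t; exact: recov.
exists (t, w').
  apply: ABP; split=> //=; apply: Brho.
  by rewrite /ball_ /= distrC (lt_le_trans w'w) // ge_min lexx orbT.
by apply: le_trans Dw' _; rewrite lee_fin lerD2l ge_min lexx.
Unshelve. all: by end_near. Qed.

(** A lower limit bounds from below every limit of points of the epigraphs, so
    epi-convergence only asks for recovery points at every small step; a diagonal
    extraction turns these into a sequence along any given steps. *)
Lemma epi_converges_liminf n (D : R -> 'rV[R]_n -> \bar R)
    (g := fun w : 'rV[R]_n => limf_einf (fun p : R * 'rV[R]_n => D p.1 p.2)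
                     (filter_prod 0^'+ (nbhs w))) :
  (forall w (a e : R), (g w <= a%:E)%E -> 0 < e ->
    \forall t \near 0^'+, exists w', `|w' - w| < e /\ (D t w' <= (a + e)%:E)%E) ->
  epi_converges D g.
Proof.
move=> recov.
have outer_sub : outer_limit (fun t => epi (D t)) `<=` epi g.
  move=> z [t [zk [tk Dk zkz]]]; exists (lsubmx z), (rsubmx z ord0 ord0).
  split; first by rewrite epairK.
  rewrite leNgt; apply/negP => lt_g.
  have [c lt_ac lt_cg] : exists2 c : R, rsubmx z ord0 ord0 < c
      & (c%:E < g (lsubmx z))%E.
    move: lt_g; case: (g _) => [r||//].
      rewrite lte_fin => ar; exists ((rsubmx z ord0 ord0 + r) / 2).
        by rewrite midf_lt.
      by rewrite lte_fin midf_lt.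
    by move=> _; exists (rsubmx z ord0 ord0 + 1); rewrite ?ltrDl ?ltry.
  have [[A B] /= [A0 Bz] ABc] : \forall p \near
      filter_prod 0^'+ (nbhs (lsubmx z)), (c%:E <= D p.1 p.2)%E.
    exact: limf_einf_gt lt_cg.
  have : c <= rsubmx z ord0 ord0.
    apply: (ler_cvg_to (cvg_cst c) (cvg_rsubmx zkz)).
    near=> k; have Ak : A (t k).
      by near: k; exact: (decreases_to0_at_right tk).
    have Bk : B (lsubmx (zk k)) by near: k; exact: (cvg_lsubmx zkz).
    have ck : (c%:E <= D (t k) (lsubmx (zk k)))%E by exact: (ABc (_, _)).
    have [x [al [zkE]]] := Dk k; rewrite zkE lsubmx_epair rsubmx_epair in ck *.
    by rewrite -lee_fin; apply: le_trans.
  by rewrite leNgt lt_ac.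
have sub_inner : epi g `<=` inner_limit (fun t => epi (D t)).
  move=> _ [w [a [-> ga]]] t tk.
  have P_near e : 0 < e -> \forall k \near \oo,
      exists w', `|w' - w| < e /\ (D (t k) w' <= (a + e)%:E)%E.
    by move=> e0; exact: (decreases_to0_at_right tk (recov _ _ _ ga e0)).
  have [r [r0 rl rP]] := diagonal_radius P_near.
  have /choice[wk wkP] k : exists wk, (exists w', `|w' - w| < r k /\
      (D (t k) w' <= (a + r k)%:E)%E) ->
      `|wk - w| < r k /\ (D (t k) wk <= (a + r k)%:E)%E.
    have [[w' w'P]|nP] := pselect (exists w', `|w' - w| < r k /\
      (D (t k) w' <= (a + r k)%:E)%E).
      by exists w'.
    by exists w.
  exists (fun k => epair (wk k) (a + r k)); split.
    apply: filterS rP => k /wkP[_ Dk].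
    by exists (wk k), (a + r k).
  apply: cvg_epair; last first.
    by rewrite -[X in _ --> X]addr0; apply: cvgD => //; exact: cvg_cst.
  apply/cvgrPdist_le => e e0; near=> k.
  have : `|wk k - w| < r k by have [] := wkP k (near rP k _).
  rewrite distrC => /ltW/le_trans; apply.
  rewrite -[r k]gtr0_norm // -normrN -sub0r.
  by near: k; move/cvgrPdist_le : rl; apply.
have inner_outer :
    inner_limit (fun t => epi (D t)) `<=` outer_limit (fun t => epi (D t)).
  move=> z /(_ _ decreases_to0_inv)[zk [[N _ NP] zkz]].
  exists (fun k => (k + N).+1%:R^-1), (fun k => zk (k + N)%N).
  have [inv0 invl] := decreases_to0_inv.
  split; last exact: (cvg_comp (addn^~ N) zk (cvg_addnr N) zkz).
    by split=> [k|]; [exact: inv0|exact: (cvg_comp (addn^~ N) _ (cvg_addnr N) invl)].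
  by move=> k; apply: NP; rewrite /= leq_addl.
split; rewrite eqEsubset; split=> //.
- exact: subset_trans inner_outer.
- exact: subset_trans outer_sub.
Unshelve. all: by end_near. Qed.

End EpiConvergence.

(** * Polyhedral sets *)

Section Polyhedral.
Context {R : realType}.

Lemma near_at_right0 (P : R -> Prop) : (\forall t \near 0^'+, P t) ->
  exists2 e : R, 0 < e & forall t, 0 < t -> t < e -> P t.
Proof.
move=> /nbhs_normP[e /= e0 He]; exists e => // t t0 te.
by apply: He => //=; rewrite /ball_ /= sub0r normrN gtr0_norm.
Qed.

Lemma segment_cvg n (y a : 'rV[R]_n) : y + t *: a @[t --> 0^'+] --> y.
Proof.
rewrite -[X in _ --> X]addr0 -(scale0r a).
apply: cvgD; first exact: cvg_cst.
by apply: cvgZr_tmp => A A0; exact: cvg_within.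
Qed.

Lemma ray_cvg n (y a : 'rV[R]_n) :
  (fun p : R * 'rV[R]_n => y + p.1 *: p.2) @ filter_prod 0^'+ (nbhs a) --> y.
Proof.
rewrite -[X in _ --> X]addr0 -(scale0r a).
apply: cvgD; first exact: cvg_cst.
apply: cvgZ; last exact: cvg_snd.
by move=> A A0; apply: cvg_fst; exact: cvg_within.
Qed.

Lemma near_snd n (a : 'rV[R]_n) (P : 'rV[R]_n -> Prop) :
  (\forall d \near a, P d) ->
  \forall p \near filter_prod (0 : R)^'+ (nbhs a), P p.2.
Proof. by move=> aP; exact: (cvg_snd aP). Qed.

Lemma near_fst n (a : 'rV[R]_n) (P : R -> Prop) :
  (\forall t \near 0^'+, P t) ->
  \forall p \near filter_prod (0 : R)^'+ (nbhs a), P p.1.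
Proof. by move=> aP; exact: (cvg_fst aP). Qed.

Lemma polyhedral_notin_near n (S : set 'rV[R]_n) y :
  polyhedral S -> ~ S y -> \forall y' \near y, ~ S y'.
Proof.
move=> [k [B [b ->]]] /existsNP[j /negP]; rewrite -ltNge => bj.
have /cvgr_gt/(_ _ bj) : dotp (B j) y' @[y' --> y] --> dotp (B j) y.
  exact: continuous_dotp.
by apply: filterS => y' /= + /(_ j); rewrite ltNge => /negP.
Qed.

Lemma polyhedral_segment n (S : set 'rV[R]_n) y y' t :
  polyhedral S -> 0 <= t <= 1 -> S y -> S y' -> S (y + t *: (y' - y)).
Proof.
move=> [k [B [b ->]]] /andP[t0 t1] Sy Sy' j.
rewrite dotpDr dotpZr dotpBr.
have := Sy j; have := Sy' j; rewrite /=; nra.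
Qed.

(** A polyhedron is conical around each of its points, so a direction is
    either feasible or bounded away from the feasible ones. *)
Lemma polyhedral_ray n (S : set 'rV[R]_n) y a :
  polyhedral S -> S y ->
  (\forall t \near 0^'+, S (y + t *: a)) \/
  (\forall p \near filter_prod 0^'+ (nbhs a), ~ S (y + p.1 *: p.2)).
Proof.
move=> [k [B [b ->]]] Sy.
have [feas|/existsNP[j /not_implyP[Bj aj]]] :=
    pselect (forall j, dotp (B j) y = b j -> dotp (B j) a <= 0); [left|right].
  apply: filter_forall => j.
  have := Sy j; rewrite /= le_eqVlt => /predU1P[Bj|Bj].
    near=> t; rewrite dotpDr dotpZr Bj gerDl mulr_ge0_le0 //.
    exact: feas.
  have /cvgr_lt/(_ _ Bj) : dotp (B j) (y + t *: a) @[t --> 0^'+] -->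
      dotp (B j) y by apply: cvg_dotpr; exact: segment_cvg.
  by apply: filterS => t; exact: ltW.
have aj0 : 0 < dotp (B j) a by rewrite ltNge; exact/negP.
have /cvgr_gt/(_ _ aj0) : dotp (B j) d @[d --> a] --> dotp (B j) a.
  exact: continuous_dotp.
move=> /near_snd; have := near_fst a (nbhs_right_gt (0 : R)).
apply: filterS2 => -[t d] /= t0 d0 /(_ j).
rewrite dotpDr dotpZr Bj gerDl leNgt => /negP; apply; exact: mulr_gt0.
Unshelve. all: by end_near. Qed.

End Polyhedral.

Arguments segment_cvg {R n} y a.
Arguments ray_cvg {R n} y a.

(** * Convex piecewise linear-quadratic functions *)

Section SecondQuotient.
Context {R : realType}.

Lemma second_quotient_fin n (phi : 'rV[R]_n -> \bar R) x v t w a b :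
  phi x = a%:E -> phi (x + t *: w) = b%:E ->
  second_quotient phi x v t w =
    ((b - a - t * dotp v w) / (2^-1 * t ^+ 2))%:E.
Proof. by move=> xa wb; rewrite /second_quotient xa wb. Qed.

Lemma second_quotient_pinfty n (phi : 'rV[R]_n -> \bar R) x v t w a :
  0 < t -> phi x = a%:E -> phi (x + t *: w) = +oo%E ->
  second_quotient phi x v t w = +oo%E.
Proof.
move=> t0 xa wb; rewrite /second_quotient xa wb /=.
by rewrite gt0_mulye // lte_fin invr_gt0 mulr_gt0 ?invr_gt0 // exprn_gt0.
Qed.

End SecondQuotient.

Section Quadratic.
Context {R : realType}.
Variables (m : nat) (A : 'M[R]_m) (a : 'rV[R]_m) (alpha : R).

Let q y := 2^-1 * dotp (y *m A) y + dotp a y + alpha.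

Lemma quadratic_lipschitz r : 0 <= r ->
  exists2 L, 0 <= L & forall y y', `|y| <= r -> `|y'| <= r ->
    q y - q y' <= L * `|y - y'|.
Proof.
move=> r0; pose N : R := m%:R; pose M := N * `|A|.
exists (N * (M * r) + N * `|a|) => [|y y' yr y'r].
  by rewrite addr_ge0 // ?mulr_ge0.
have M0 : 0 <= M by rewrite mulr_ge0.
have -> : q y - q y' = 2^-1 * (dotp ((y - y') *m A) y
    + dotp (y' *m A) (y - y')) + dotp a (y - y').
  by rewrite /q mulmxBl !dotpBl !dotpBr; lra.
have h1 : dotp ((y - y') *m A) y <= N * (M * r) * `|y - y'|.
  apply: le_trans (dotp_le _ _) _.
  apply: le_trans (ler_wpM2l _ yr) _; first by rewrite mulr_ge0.
  have -> : N * (M * r) * `|y - y'| = m%:R * (M * `|y - y'|) * r.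
    by rewrite -/N; ring.
  by rewrite ler_wpM2r // ler_wpM2l // mulmx_norm_le.
have h2 : dotp (y' *m A) (y - y') <= N * (M * r) * `|y - y'|.
  apply: le_trans (dotp_le _ _) _; rewrite ler_wpM2r // ler_wpM2l //.
  by apply: le_trans (mulmx_norm_le _ _) _; rewrite ler_wpM2l.
have h3 := dotp_le a (y - y').
rewrite mulrDl; lra.
Qed.

Hypothesis A_sym : A^T = A.

Lemma quadratic_expansion y d t :
  q (y + t *: d) =
  q y + t * dotp (y *m A + a) d + 2^-1 * t ^+ 2 * dotp (d *m A) d.
Proof.
rewrite /q mulmxDl -scalemxAl !dotpDl !dotpDr !dotpZl !dotpZr.
have -> : dotp (d *m A) y = dotp (y *m A) d.
  by rewrite dotp_mulmx A_sym /dotp; apply: eq_bigr => i _; rewrite mulrC.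
by field.
Qed.

End Quadratic.

Section PWLQ.
Context {R : realType}.
Variables (m : nat) (theta : 'rV[R]_m -> \bar R).
Hypotheses (thetaNy : forall y, theta y != -oo%E)
  (theta_conv : econvex theta) (theta_pwlq : PWLQ theta).

Local Notation dom := (edom theta).
Local Notation th := (fun y => fine (theta y)).

Lemma theta_fine y : dom y -> theta y = (th y)%:E.
Proof. by move=> dy; rewrite fineK // fin_numElt ltNye thetaNy. Qed.

Lemma notin_dom y : ~ dom y -> theta y = +oo%E.
Proof. by move=> /negP; rewrite -leNgt leye_eq => /eqP. Qed.

Lemma theta_segment y y' t : dom y -> dom y' -> 0 <= t <= 1 ->
  (theta (y + t *: (y' - y)) <= (th y + t * (th y' - th y))%:E)%E.
Proof.
move=> dy dy' /andP[]; rewrite le_eqVlt => /predU1P[<- _|t0].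
  by rewrite scale0r addr0 mul0r addr0 -theta_fine.
rewrite le_eqVlt => /predU1P[->|t1].
  by rewrite scale1r mul1r !(addrC _ (_ - _)) !subrK -theta_fine.
have -> : y + t *: (y' - y) = t *: y' + (1 - t) *: y.
  by apply/rowP => i; rewrite !mxE; ring.
apply: le_trans (theta_conv _ _ t0 t1) _.
by rewrite (theta_fine dy) (theta_fine dy') /= -!EFinM -EFinD lee_fin; lra.
Qed.

Lemma dom_segment y y' t : dom y -> dom y' -> 0 <= t <= 1 ->
  dom (y + t *: (y' - y)).
Proof.
move=> dy dy' t01; rewrite /edom /=.
exact: le_lt_trans (theta_segment dy dy' t01) (ltry _).
Qed.

Lemma th_segment y y' t : dom y -> dom y' -> 0 <= t <= 1 ->
  th (y + t *: (y' - y)) <= th y + t * (th y' - th y).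
Proof.
move=> dy dy' t01; have := theta_segment dy dy' t01.
by rewrite (theta_fine (dom_segment dy dy' t01)) lee_fin.
Qed.

(** The pieces that miss [y] are closed, hence miss a neighbourhood of it. *)
Lemma near_common_piece s (Omega : 'I_s -> set 'rV[R]_m) (y : 'rV[R]_m) :
  (forall i, polyhedral (Omega i)) -> dom = \bigcup_i Omega i ->
  \forall y' \near y, dom y' -> exists i, Omega i y /\ Omega i y'.
Proof.
move=> poly domE.
have : \forall y' \near y, forall i, ~ Omega i y -> ~ Omega i y'.
  apply: (@filter_forall _ _ _ (nbhs y) _) => i.
  have [Oy|nOy] := pselect (Omega i y); first by apply: nearW.
  by apply: filterS (polyhedral_notin_near (poly i) nOy).
apply: filterS => y' Oy'; rewrite domE => -[i _ Oi]; exists i; split=> //.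
by apply: contrapT => /Oy'.
Qed.

(** Convexity bounds a difference quotient by the one over a final subsegment,
    which stays in a single quadratic piece. *)
Lemma th_locally_lipschitz ybar : exists2 L, 0 <= L &
  \forall y \near ybar, forall y', `|y' - ybar| < 1 -> dom y -> dom y' ->
    th y - th y' <= L * `|y - y'|.
Proof.
have [s [ Omega [A [a [alpha [poly Asym domE quad]]]]]] := theta_pwlq.
pose r := `|ybar| + 1.
have r0 : 0 <= r by rewrite addr_ge0.
have /choice[Lip LipP] i : exists L, 0 <= L /\
    forall y y', `|y| <= r -> `|y'| <= r -> Omega i y -> Omega i y' ->
    th y - th y' <= L * `|y - y'|.
  have [L L0 Li] := quadratic_lipschitz (A i) (a i) (alpha i) r0.
  by exists L; split=> // y y' yr y'r Oy Oy'; rewrite (quad i y) // (quad i y') //; exact: Li.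
exists (\sum_i Lip i) => [|]; first by apply: sumr_ge0 => i _; have [] := LipP i.
have in_ball y : `|y - ybar| < 1 -> `|y| <= r.
  move=> yb; rewrite -(subrK ybar y) (le_trans (ler_normD _ _)) // /r addrC.
  by rewrite lerD2l ltW.
near=> y => y' y'1 dy dy'.
have y1 : `|y - ybar| < 1 by rewrite distrC; near: y; exact: cvgr_dist_lt.
have piece : \forall t \near (0 : R)^'+, dom (y + t *: (y' - y)) ->
    exists i, Omega i y /\ Omega i (y + t *: (y' - y)).
  exact: (segment_cvg y (y' - y) _ (near_common_piece y poly domE)).
near (0 : R)^'+ => t.
have t0 : 0 < t by near: t; exact: nbhs_right_gt.
have t1 : t <= 1 by near: t; exact: nbhs_right_le.
have t01 : 0 <= t <= 1 by rewrite ltW.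
pose p := y + t *: (y' - y).
have dp : dom p by exact: dom_segment.
have p1 : `|p - ybar| < 1.
  have -> : p - ybar = (1 - t) *: (y - ybar) + t *: (y' - ybar).
    by apply/rowP => i; rewrite !mxE; ring.
  rewrite (le_lt_trans (ler_normD _ _)) // !normrZ ger0_norm ?subr_ge0 //.
  rewrite gtr0_norm //; nra.
have [i [Oy Op]] : exists i, Omega i y /\ Omega i p.
  by move: dp; rewrite /p; near: t.
have [Li0 Li] := LipP i.
have := Li _ _ (in_ball _ y1) (in_ball _ p1) Oy Op.
have := th_segment dy dy' t01; rewrite -/p /=.
have -> : y - p = t *: (y - y') by apply/rowP => k; rewrite !mxE; ring.
rewrite normrZ gtr0_norm // => h1 h2.
have : t * (th y - th y') <= t * (Lip i * `|y - y'|) by rewrite /=; lra.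
rewrite ler_pM2l // => /le_trans; apply; rewrite ler_wpM2r //.
rewrite (bigD1 i) //= lerDl; apply: sumr_ge0 => j _.
by have [] := LipP j.
Unshelve. all: by end_near. Qed.

Definition subgradient y lambda :=
  forall y', dom y' -> th y + dotp lambda (y' - y) <= th y'.

(** The epigraph is convex, so its regular normals satisfy the global
    inequality, which survives the passage to the limit. *)
Lemma subdifferentialP y lambda : dom y ->
  subdifferential theta y lambda <-> subgradient y lambda.
Proof.
move=> dy; have tfin : theta y \is a fin_num by rewrite theta_fine.
split=> [[_ [xk [vk [xepi vN xlim vlim]]]] y' dy'|sub].
  have le0 k : dotp (vk k) (epair y' (th y') - xk k) <= 0.
    apply: (regular_normal_segment (vN k)) => t t0 t1.
    have [x [al [-> xal]]] := xepi k.
    have dx : dom x by exact: le_lt_trans xal (ltry _).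
    have t01 : 0 <= t <= 1 by rewrite !ltW.
    exists (x + t *: (y' - x)), (al + t * (th y' - al)).
    split; first by rewrite epairB epairZ epairD.
    apply: le_trans (theta_segment dx dy' t01) _.
    by move: xal; rewrite (theta_fine dx) !lee_fin /=; nra.
  have : dotp (epair lambda (-1)) (epair y' (th y') - epair y (th y)) <= 0.
    have lim : dotp (vk k) (epair y' (th y') - xk k) @[k --> \oo] -->
        dotp (epair lambda (-1)) (epair y' (th y') - epair y (th y)).
      apply: cvg_dotp vlim _; apply: cvgB xlim; exact: cvg_cst.
    by apply: (ler_cvg_to lim (cvg_cst 0)); apply: nearW.
  by rewrite epairB dotp_epair /=; lra.
split=> //; exists (fun=> epair y (th y)), (fun=> epair lambda (-1)).
split.
- by move=> _; exists y, (th y); rewrite -theta_fine.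
- move=> _; apply: regular_normal_of_le0 => _ [x [al [-> xal]]].
  have dx : dom x by exact: le_lt_trans xal (ltry _).
  move: xal (sub x dx); rewrite (theta_fine dx) lee_fin epairB dotp_epair /=.
  by lra.
- exact: cvg_cst.
- exact: cvg_cst.
Qed.

Section Dichotomy.
Variables (ybar lambda a : 'rV[R]_m).
Hypotheses (dy : dom ybar) (lam : subgradient ybar lambda).

Local Notation d2theta := (second_subderivative theta ybar lambda a).
Local Notation near_a := (filter_prod (0 : R)^'+ (nbhs a)).

Lemma second_subderivative_ge (c : R) :
  (\forall p \near near_a, dom (ybar + p.1 *: p.2) ->
    c * (2^-1 * p.1 ^+ 2) <=
    th (ybar + p.1 *: p.2) - th ybar - p.1 * dotp lambda p.2) ->
  (c%:E <= d2theta)%E.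
Proof.
move=> cle; apply: limf_einf_ge.
have := near_fst a (nbhs_right_gt (0 : R)); move: cle.
apply: filterS2 => -[t d] /= + t0.
have [dd /(_ dd)|/notin_dom nd _] := pselect (dom (ybar + t *: d)).
  rewrite (second_quotient_fin _ (theta_fine dy) (theta_fine dd)) lee_fin.
  by rewrite ler_pdivlMr // mulr_gt0 ?invr_gt0 // exprn_gt0.
by rewrite (second_quotient_pinfty _ t0 (theta_fine dy) nd) leey.
Qed.

(** In the direction [a] the function is either exactly quadratic for small
    steps, or strictly steeper than [lambda], or infinite. *)
Lemma second_subderivative_dichotomy :
  d2theta = +oo%E \/ exists2 Q : R, (Q%:E <= d2theta)%E &
    \forall t \near 0^'+, theta (ybar + t *: a) =
      (th ybar + t * dotp lambda a + 2^-1 * t ^+ 2 * Q)%:E.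
Proof.
have pinfty : (forall c : R, (c%:E <= d2theta)%E) -> d2theta = +oo%E.
  by move=> ge; apply/eqyP => c _; exact: ge.
have [s [ Omega [A [al [alpha [poly Asym domE quad]]]]]] := theta_pwlq.
(* The pieces that the ray enters; by [piece] below, no other one meets the
   points [ybar + t *: d] with [t] small and [d] close to [a]. *)
pose feas i := Omega i ybar /\ \forall t \near 0^'+, Omega i (ybar + t *: a).
pose h i := dotp (ybar *m A i + al i) a.
pose Q i := dotp (a *m A i) a.
have expand i t d : Omega i ybar -> Omega i (ybar + t *: d) ->
    th (ybar + t *: d) - th ybar =
    t * dotp (ybar *m A i + al i) d + 2^-1 * t ^+ 2 * dotp (d *m A i) d.
  move=> Oy Od; rewrite (quad i ybar) // (quad i (_ + _)) //=.
  by rewrite quadratic_expansion //; ring.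
have piece : \forall p \near near_a, dom (ybar + p.1 *: p.2) ->
    exists2 i, feas i & Omega i (ybar + p.1 *: p.2).
  have : \forall p \near near_a, forall i, Omega i ybar -> ~ feas i ->
      ~ Omega i (ybar + p.1 *: p.2).
    apply: filter_forall => i.
    have [Oy|nOy] := pselect (Omega i ybar); last by apply: nearW.
    have [Oa|nO] := polyhedral_ray a (poly i) Oy.
      by apply: nearW => p _ [].
    by apply: filterS nO.
  have : \forall p \near near_a, dom (ybar + p.1 *: p.2) ->
      exists i, Omega i ybar /\ Omega i (ybar + p.1 *: p.2).
    exact: (ray_cvg ybar a _ (near_common_piece ybar poly domE)).
  apply: filterS2 => p /= common infeas dp.
  have [i [Oy Op]] := common dp; exists i => //.
  by apply: contrapT => nf; exact: (infeas i).
have [[i0 [Oi0 near_i0]]|nofeas] := pselect (exists i, feas i); last first.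
  left; apply: pinfty => c; apply: second_subderivative_ge.
  apply: filterS piece => p /= + dp => /(_ dp)[i fi _].
  by case: nofeas; exists i.
(* Two pieces containing the same short ray carry the same polynomial there. *)
have same i : feas i -> h i = h i0 /\ Q i = Q i0.
  move=> [Oi near_i].
  have [r r0 Hr] := near_at_right0 (filterI near_i near_i0).
  have eqt t : 0 < t -> t < r ->
      h i + 2^-1 * t * Q i = h i0 + 2^-1 * t * Q i0.
    move=> t0 tr; have [ O1 O2] := Hr _ t0 tr.
    have := expand _ _ _ Oi O1; rewrite (expand _ _ _ Oi0 O2).
    rewrite -/(h i) -/(h i0) -/(Q i) -/(Q i0) => e.
    apply: (mulfI (lt0r_neq0 t0)); move: e; rewrite expr2; lra.
  have r2 : 0 < r / 2 by rewrite divr_gt0.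
  have r4 : 0 < r / 4 by rewrite divr_gt0.
  have e2 := eqt _ r2; have e4 := eqt _ r4.
  have QQ : Q i = Q i0.
    apply: (mulfI (lt0r_neq0 r4)).
    have := e2 _; have := e4 _; lra.
  by split=> //; have := e2 _; rewrite QQ; lra.
have hQ t : 0 < t -> Omega i0 (ybar + t *: a) ->
    th (ybar + t *: a) - th ybar = t * h i0 + 2^-1 * t ^+ 2 * Q i0.
  by move=> t0; exact: expand.
have dom_piece i y : Omega i y -> dom y by move=> Oy; rewrite domE; exists i.
(* The quadratic term disappears from the subgradient inequality along the
   segment as the step [tau] shrinks. *)
have slope_dominates i t d : Omega i ybar -> 0 < t ->
    Omega i (ybar + t *: d) -> dotp lambda d <= dotp (ybar *m A i + al i) d.
  move=> Oy t0 Ot; apply/ler_addgt0Pr => e e0.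
  set q := dotp (d *m A i) d; pose tau := Num.min t (e / (`|q| + 1)).
  have q1 : 0 < `|q| + 1 by rewrite ltr_wpDl.
  have tau0 : 0 < tau by rewrite lt_min t0 divr_gt0.
  have Otau : Omega i (ybar + tau *: d).
    have taut : 0 <= tau / t <= 1.
      by rewrite (ltW (divr_gt0 tau0 t0)) ler_pdivrMr // mul1r ge_min lexx.
    have := polyhedral_segment (poly i) taut Oy Ot.
    by rewrite (addrC (ybar + _)) addKr scalerA divfK // gt_eqF.
  have := lam (dom_piece _ _ Otau); have := expand _ _ _ Oy Otau.
  rewrite (addrC ybar) addrK dotpZr -/q => eq le.
  have tauq : tau * q <= e.
    have le1 : tau * q <= tau * (`|q| + 1).
      by rewrite ler_pM2l // (le_trans (ler_norm _)) // lerDl.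
    apply: le_trans le1 _; rewrite -ler_pdivlMr //.
    by rewrite ge_min lexx orbT.
  rewrite -(ler_pM2l tau0).
  have : tau * (tau * q) <= tau * e by rewrite ler_pM2l.
  have : 0 < tau * e by rewrite mulr_gt0.
  move: eq le; rewrite expr2 /=; lra.
have h_ge : dotp lambda a <= h i0.
  have [r r0 Hr] := near_at_right0 near_i0.
  have r2 : 0 < r / 2 by rewrite divr_gt0.
  apply: (slope_dominates _ _ _ Oi0 r2); apply: Hr => //.
  by rewrite ltr_pdivrMr //; lra.
have quad_ge e : 0 < e -> \forall p \near near_a, forall i, feas i ->
    Q i0 - e <= dotp (p.2 *m A i) p.2.
  move=> e0; apply: filter_forall => i.
  have [/same[_ QQ]|nf] := pselect (feas i); last by apply: nearW.
  have : \forall d \near a, Q i0 - e <= dotp (d *m A i) d.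
    have lim : dotp (d *m A i) d @[d --> a] --> Q i.
      apply: (@cvg_dotp _ _ (nbhs a) _ (fun d => d *m A i) id) => //.
      exact: (@cvg_mulmx _ _ (nbhs a) _ _ id).
    apply: (cvgr_ge _ lim); rewrite QQ; lra.
  by move/near_snd; apply: filterS => p + _.
have slope_ge (delta : R) : delta < h i0 - dotp lambda a ->
    \forall p \near near_a, forall i, feas i ->
    delta <= dotp (ybar *m A i + al i - lambda) p.2.
  move=> lt; apply: filter_forall => i.
  have [/same[hh _]|nf] := pselect (feas i); last by apply: nearW.
  have : \forall d \near a, delta <= dotp (ybar *m A i + al i - lambda) d.
    apply: (cvgr_ge _ (continuous_dotp _ a)).
    by rewrite dotpBl -/(h i) hh.
  by move/near_snd; apply: filterS => p + _.
have t_gt0 := near_fst a (nbhs_right_gt (0 : R)).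
move: h_ge; rewrite le_eqVlt => /predU1P[heq|hlt].
  right; exists (Q i0); last first.
    have := nbhs_right_gt (0 : R); move: near_i0.
    apply: filterS2 => t Oa t0.
    rewrite (theta_fine (dom_piece _ _ Oa)); congr EFin.
    by have := hQ _ t0 Oa; rewrite heq; lra.
  apply/lee_subgt0Pr => e e0; rewrite -EFinB; apply: second_subderivative_ge.
  move: piece t_gt0 (quad_ge _ e0); apply: filterS3 => -[t d] /= pi t0 Qe dd.
  have [i fi Oi] := pi dd; have {}Qe := Qe i fi.
  rewrite (expand i) //; last by case: fi.
  have : 0 <= dotp (ybar *m A i + al i) d - dotp lambda d.
    by rewrite subr_ge0; apply: (slope_dominates i t) => //; case: fi.
  move=> /(mulr_ge0 (ltW t0)) le.
  have : 2^-1 * t ^+ 2 * (Q i0 - e) <= 2^-1 * t ^+ 2 * dotp (d *m A i) d.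
    by rewrite ler_pM2l // mulr_gt0 ?invr_gt0 // exprn_gt0.
  by lra.
left; apply: pinfty => c; apply: second_subderivative_ge.
(* A gap of [delta] between the slopes contributes [t * delta] to the excess,
   which exceeds any multiple of [t ^+ 2]. *)
pose delta : R := (h i0 - dotp lambda a) / 2.
have delta0 : 0 < delta by rewrite divr_gt0 // subr_gt0.
have lt_delta : delta < h i0 - dotp lambda a.
  by rewrite ltr_pdivrMr //; lra.
clearbody delta.
have [k k0 le_k] : exists2 k : R, 0 < k & c - (Q i0 - 1) <= k.
  exists (`|c - (Q i0 - 1)| + 1); first by rewrite ltr_wpDl.
  by rewrite (le_trans (ler_norm _)) // lerDl.
have t_small : \forall p \near near_a, p.1 <= 2 * delta / k.
  apply: (near_fst a (P := fun t => t <= 2 * delta / k)).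
  by apply: nbhs_right_le; rewrite divr_gt0 // mulr_gt0.
have SQ : \forall p \near near_a, forall i, feas i ->
    delta <= dotp (ybar *m A i + al i - lambda) p.2 /\
    Q i0 - 1 <= dotp (p.2 *m A i) p.2.
  have := quad_ge _ ltr01; have := slope_ge _ lt_delta.
  by apply: filterS2 => p Se Qe i fi; split; [exact: Se|exact: Qe].
have t_ok : \forall p \near near_a, 0 < p.1 /\ p.1 <= 2 * delta / k.
  by move: t_gt0 t_small; apply: filterS2 => p.
move: piece SQ t_ok; apply: filterS3 => -[t d] /= pi SQ [t0 tk] dd.
have [i fi Oi] := pi dd; have [Se Qe] := SQ i fi.
rewrite (expand i) //; last by case: fi.
move: Se; rewrite dotpBl -(ler_pM2l t0) => Se.
have t20 : 0 < 2^-1 * t ^+ 2 by rewrite mulr_gt0 ?invr_gt0 // exprn_gt0.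
move: Qe; rewrite -(ler_pM2l t20) => Qe.
have : 2^-1 * t ^+ 2 * (c - (Q i0 - 1)) <= t * delta.
  apply: (le_trans (ler_wpM2l (ltW t20) le_k)).
  by move: tk; rewrite ler_pdivlMr // => /(ler_wpM2l (ltW t0)); rewrite expr2; lra.
by move: Se Qe; rewrite !mulrBr; lra.
Qed.

End Dichotomy.
End PWLQ.

(** * Second-order expansion *)

Section Taylor.
Context {R : realType}.

Lemma diff_near (V W : normedModType R) (f : V -> W) x e :
  differentiable f x -> 0 < e ->
  \forall h \near (0 : V), `|f (h + x) - f x - 'd f x h| <= e * `|h|.
Proof.
move=> /diff_locally /eqaddoP df e0; have := df _ e0.
by apply: filterS => h /=; rewrite /cst /= !fctE opprD addrA.
Qed.

Lemma jacobian_near n m (f : 'rV[R]_n -> 'rV[R]_m) x e :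
  differentiable f x -> 0 < e ->
  \forall y \near x, `|f y - f x - (y - x) *m 'J f x| <= e * `|y - x|.
Proof.
move=> df e0; have := diff_near df e0.
move=> near0; apply/nbhs0P; apply: filterS near0 => h.
by rewrite (addrC x) addrK mul_rV_lin1.
Qed.

Lemma gradient_coord n m (f : 'rV[R]_n -> 'rV[R]_m) y i :
  differentiable f y ->
  gradient (fun y => f y ord0 i) y = row i ('J f y)^T.
Proof.
move=> df; apply/rowP => j; rewrite !mxE.
have dfi : differentiable (fun y => f y ord0 i : R^o) y.
  by apply: (@differentiable_comp _ _ _ _ f (fun M => M ord0 i));
    [exact: df|exact: differentiable_coord].
rewrite -deriveE //.
have := derive_mx (@diff_derivable _ _ _ f y (delta_mx ord0 j) df).
rewrite deriveE // => /rowP/(_ i); rewrite mxE => <- /=.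
by rewrite ord1.
Qed.

(** The second differential of [f] is the differential of its Jacobian. *)
Lemma second_derivativeE n m (f : 'rV[R]_n -> 'rV[R]_m) x w v :
  twice_differentiable f x ->
  second_derivative f x w v = v *m 'd (fun y => 'J f y) x w.
Proof.
move=> [df dJ]; set G := fun y => 'J f y in dJ *.
apply/rowP => i; rewrite !mxE.
(* The derivative at [x] of the gradient of the [i]th coordinate. *)
pose L : {linear 'rV[R]_n -> 'rV[R]_n} := row i \o trmx \o 'd G x.
have normL M : `|row i (M^T : 'M[R]_(m, n))| <= `|M|.
  by apply: mx_norm_le => // k j; rewrite !mxE mx_coord_le.
have Lcont : continuous L.
  suff Lc (y : 'rV[R]_n) : L y' @[y' --> y] --> L y by move=> y; exact: Lc.
  have /cvgrPdist_le dcont : 'd G x y' @[y' --> y] --> 'd G x y.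
    exact: diff_continuous.
  apply/(@cvgrPdist_le _ _ _ (nbhs y) _ L (L y)) => e /dcont.
  apply: filterS => y'; apply: le_trans.
  by rewrite /L /= -!raddfB normL.
set g := fun y => f y ord0 i.
have gradE : \forall y \near x, gradient g y = row i (G y)^T.
  by apply: filterS df => y; exact: gradient_coord.
have -> : hessian g x = lin1_mx L.
  rewrite /hessian /jacobian (diff_unique (df := L)) //.
  apply/eqaddoP => e e0.
  have gradx := nbhs_singleton gradE.
  have := diff_near dJ e0; move: gradE => /nbhs0P.
  apply: filterS2 => h /= gE; apply: le_trans.
  rewrite !fctE /= (addrC h) gE gradx /cst.
  by rewrite opprD addrA -!raddfB (addrC x) normL.
rewrite mul_rV_lin1 /dotp /L /=; apply: eq_bigr => j _.
by rewrite !mxE mulrC.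
Qed.

(** Only the derivative of the Jacobian at [x] itself is available, so the mean
    value theorem is applied once, coordinatewise, to the remainder along the
    segment, and its derivative is bounded by the differentiability of the
    Jacobian at [x]. *)
Lemma taylor2 n m (f : 'rV[R]_n -> 'rV[R]_m) x e :
  twice_differentiable f x -> 0 < e ->
  \forall y \near x, `|f y - f x - (y - x) *m 'J f x
    - 2^-1 *: second_derivative f x (y - x) (y - x)| <= e * `|y - x| ^+ 2.
Proof.
move=> td e0; have [df dJ] := td; set G := fun y => 'J f y in dJ *.
have e1 : 0 < e / n.+1%:R by rewrite divr_gt0.
have /nbhs_normP[r /= r0 Hr] := df.
have := diff_near dJ e1; move=> /nbhs_normP[r1 /= r10 Hr1].
apply/nbhs0P; apply/nbhs_normP; exists (Num.min r r1) => /=.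
  by rewrite lt_min r0.
move=> h /=; rewrite /ball_ /= sub0r normrN lt_min => /andP[hr hr1].
rewrite (addrC x) addrK second_derivativeE // -/G.
apply: mx_norm_le => [|k i]; first by rewrite mulr_ge0 // ltW.
rewrite (ord1 k) {k}.
pose c1 : R := (h *m G x) ord0 i; pose c2 : R := (h *m 'd G x h) ord0 i.
pose psi (s : R) := f (s *: h + x) ord0 i - s * c1 - 2^-1 * s ^+ 2 * c2.
pose dpsi (s : R) : R := (h *m (G (s *: h + x) - G x - 'd G x (s *: h))) ord0 i.
have sh (s : R) : s \in `[0, 1]%R -> `|s *: h| <= `|h|.
  rewrite in_itv /= => /andP[s0 s1]; rewrite normrZ ger0_norm //.
  by rewrite ler_piMl.
have dpsiP (s : R) : s \in `[0, 1]%R -> is_derive s (1 : R) (psi : R -> R) (dpsi s).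
  move=> s01.
  have dfs : differentiable f (s *: h + x).
    apply: Hr; rewrite /ball_ /= distrC addrK; exact: le_lt_trans (sh _ s01) hr.
  pose F : R -> R := fun s => f (s *: h + x) ord0 i.
  have dF : is_derive s (1 : R) (F : R -> R) ((h *m G (s *: h + x)) ord0 i).
    pose seg : R -> 'rV[R]_n := fun s => s *: h + x.
    have [seg_diff segE] : is_diff s seg ( *:%R ^~ h).
      by apply: is_diff_eq; rewrite addr0.
    have dfseg : differentiable (f \o seg) s by exact: differentiable_comp.
    have dF : derivable (F : R -> R) s 1.
      apply: diff_derivable.
      by apply: (@differentiable_comp _ _ _ _ (f \o seg) (fun M => M ord0 i));
        [exact: dfseg|exact: differentiable_coord].
    apply: DeriveDef => //.
    have := derive_mx (@diff_derivable _ _ _ (f \o seg) s 1 dfseg).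
    rewrite deriveE // diff_comp // => /rowP/(_ i); rewrite mxE /= segE scale1r.
    by rewrite /G mul_rV_lin1 (ord1 ord0) => ->.
  have -> : dpsi s = (h *m G (s *: h + x)) ord0 i - c1 - s * c2.
    rewrite /dpsi linearZ /= mulmxBr mulmxBr -scalemxAr !mxE.
    by rewrite /c1 /c2 !mxE.
  pose p : {poly R} := c1 *: 'X + (2^-1 * c2) *: 'X^2.
  have pE u : p.[u] = u * c1 + 2^-1 * u ^+ 2 * c2.
    by rewrite /p hornerD !hornerZ hornerX hornerXn; ring.
  have -> : psi = F - horner p.
    by apply/funext => u; rewrite -[RHS]/(F u - p.[u]) pE /psi /F; ring.
  have -> : (h *m G (s *: h + x)) ord0 i - c1 - s * c2 =
      (h *m G (s *: h + x)) ord0 i - p^`().[s].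
    by rewrite /p derivD !derivZ derivX derivXn !hornerE /=; field.
  exact: is_deriveB dF (is_derive_poly p s).
have dpsi_oo (s : R) : s \in `]0, 1[%R -> is_derive s (1 : R) (psi : R -> R) (dpsi s).
  by move=> s01; apply: dpsiP; apply: subset_itv_oo_cc.
have psi_cont : {within `[0, 1], continuous (psi : R -> R)}.
  apply: derivable_within_continuous => s /dpsiP ds.
  exact: ex_derive.
have [c c01] := @MVT_segment R psi dpsi 0 1 ler01 dpsi_oo psi_cont.
rewrite subr0 mulr1 {1 2}/psi scale1r scale0r add0r => psiE.
have -> : (f (h + x) - f x - h *m 'J f x - 2^-1 *: (h *m 'd G x h)) ord0 i
    = dpsi c.
  by rewrite -psiE !mxE /c1 /c2 /G !mxE expr1n expr0n /=; ring.
have c_h := sh _ c01.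
have hcr : `|c *: h| < r1 by exact: le_lt_trans hr1.
have Dc : `|G (c *: h + x) - G x - 'd G x (c *: h)| <= e / n.+1%:R * `|h|.
  have /= := Hr1 (c *: h); rewrite /ball_ /= sub0r normrN => /(_ hcr) le.
  by apply: le_trans le _; rewrite ler_wpM2l // ltW.
rewrite /dpsi; apply: le_trans (mx_coord_le _ _ _) _.
apply: le_trans (mulmx_norm_le _ _) _.
rewrite expr2 mulrA ler_wpM2r //.
apply: le_trans (ler_wpM2l _ Dc) _; first by [].
rewrite mulrA ler_wpM2r // mulrA ler_pdivrMr // mulrC.
by rewrite ler_wpM2l ?ler_nat // ltW.
Qed.

(** The expansion along the directions close to [w], in the scaling of the
    second-order difference quotients. *)
Lemma taylor2_ray n m (f : 'rV[R]_n -> 'rV[R]_m) x w e :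
  twice_differentiable f x -> 0 < e ->
  \forall p \near filter_prod (0 : R)^'+ (nbhs w),
    `|f (x + p.1 *: p.2) - f x - p.1 *: (p.2 *m 'J f x)
      - (2^-1 * p.1 ^+ 2) *: second_derivative f x w w| <= e * p.1 ^+ 2.
Proof.
move=> td e0.
pose L := 'd (fun y => 'J f y) x; pose z := second_derivative f x.
have zE u v : z u v = v *m L u by exact: second_derivativeE.
have k0 : 0 < (`|w| + 1) ^+ 2 by rewrite exprn_gt0 // ltr_wpDl.
have e1 : 0 < e / 2 / (`|w| + 1) ^+ 2 by rewrite !divr_gt0.
have tay : \forall p \near filter_prod (0 : R)^'+ (nbhs w),
   `|f (x + p.1 *: p.2) - f x - (x + p.1 *: p.2 - x) *m 'J f x
    - 2^-1 *: z (x + p.1 *: p.2 - x) (x + p.1 *: p.2 - x)|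
   <= e / 2 / (`|w| + 1) ^+ 2 * `|x + p.1 *: p.2 - x| ^+ 2.
  exact: (ray_cvg x w _ (taylor2 td e1)).
have norm_near (u : 'rV[R]_n) : `|w - u| < 1 -> `|u| <= `|w| + 1.
  move=> wu; rewrite -(subrK w u) addrC (le_trans (ler_normD _ _)) //.
  by rewrite lerD2l distrC ltW.
have [k kpos Lk] : exists2 k : R, k > 0 & forall u, `|L u| <= k * `|u|.
  by apply: linear_lipschitz; apply: diff_continuous; case: td.
pose K : R := n%:R * k * (`|w| + 1) + n%:R * (k * `|w|) + 1.
have K0 : 0 < K by rewrite ltr_wpDl // addr_ge0 // !mulr_ge0 // ltW.
(* The quadratic form at [u] is replaced by the one at the fixed vector [w]. *)
have z_cont (u : 'rV[R]_n) : `|w - u| < 1 -> `|z u u - z w w| <= K * `|w - u|.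
  move=> wu; rewrite !zE.
  have -> : u *m L u - w *m L w = w *m L (u - w) - (w - u) *m L u.
    by rewrite linearB /= mulmxBr mulmxBl opprB [RHS]addrC addrA subrK.
  apply: le_trans (ler_normB _ _) _.
  have h1 : `|w *m L (u - w)| <= n%:R * (k * `|w|) * `|w - u|.
    apply: le_trans (mulmx_norm_le _ _) _.
    have -> : n%:R * (k * `|w|) * `|w - u| = n%:R * (k * `|w - u|) * `|w|.
      by ring.
    by rewrite ler_wpM2r // ler_wpM2l // distrC.
  have h2 : `|(w - u) *m L u| <= n%:R * k * (`|w| + 1) * `|w - u|.
    apply: le_trans (mulmx_norm_le _ _) _; rewrite ler_wpM2r // -mulrA.
    by rewrite ler_wpM2l // (le_trans (Lk _)) // ler_wpM2l ?norm_near // ltW.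
  have : 0 <= `|w - u| by [].
  by rewrite /K !mulrDl; lra.
have w_near : \forall p \near filter_prod (0 : R)^'+ (nbhs w),
    `|w - p.2| < 1 /\ K * `|w - p.2| <= e.
  apply: (near_snd (P := fun u => `|w - u| < 1 /\ K * `|w - u| <= e)).
  apply/nbhs_normP; exists (Num.min 1 (e / K)).
    by rewrite /= lt_min ltr01 divr_gt0.
  move=> u; rewrite /ball_ /= lt_min => /andP[-> /ltW].
  by rewrite ler_pdivlMr // mulrC.
move: tay w_near (near_fst w (nbhs_right_gt (0 : R))).
apply: filterS3 => -[t u] /= + [wu Ke] t0.
rewrite (addrC x) addrK -scalemxAl => le.
have t20 : 0 < 2^-1 * t ^+ 2 by rewrite mulr_gt0 ?invr_gt0 // exprn_gt0.
have zt : 2^-1 *: z (t *: u) (t *: u) = (2^-1 * t ^+ 2) *: z u u.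
  by rewrite !zE linearZ /= -scalemxAl -scalemxAr !scalerA mulrA.
rewrite zt in le.
set a := f _ - f x - _ in le *.
have -> : a - (2^-1 * t ^+ 2) *: second_derivative f x w w =
    (a - (2^-1 * t ^+ 2) *: z u u) + (2^-1 * t ^+ 2) *: (z u u - z w w).
  by rewrite scalerBr addrA subrK.
apply: le_trans (ler_normD _ _) _.
have le1 : `|a - (2^-1 * t ^+ 2) *: z u u| <= e / 2 * t ^+ 2.
  apply: le_trans le _; rewrite normrZ gtr0_norm // exprMn mulrCA mulrC.
  rewrite ler_wpM2r ?sqr_ge0 // mulrAC ler_pdivrMr // ler_wpM2l //.
    by rewrite divr_ge0 // ltW.
  by rewrite ler_pXn2r ?nnegrE ?addr_ge0 // norm_near.
have le2 : `|(2^-1 * t ^+ 2) *: (z u u - z w w)| <= 2^-1 * t ^+ 2 * e.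
  rewrite normrZ gtr0_norm // ler_pM2l //.
  by apply: le_trans (z_cont _ wu) Ke.
lra.
Qed.

End Taylor.

(** * Feasibility restoration under metric subregularity *)

Section ErrorTerms.
Context {R : realType}.
Implicit Types t k h Q e : R.

Lemma convex_weight_le t : 0 < t -> t <= 2^-1 -> t / (1 - t) <= 2 * t.
Proof. by move=> t0 t2; rewrite ler_pdivrMr; nra. Qed.

(** The rescaling by [1 / (1 - t)] of a quadratic piece changes its second-order
    coefficient by a term of order [t]. *)
Lemma convex_combination_expansion t c h Q s D e v1 v2 (k := t / (1 - t)) :
  0 < t -> t <= 2^-1 -> t * (4 * (`|Q| + 1)) <= e ->
  v1 = c + k * h + 2^-1 * k ^+ 2 * Q -> v2 <= c + t * s / 2 * D ->
  v1 + t * (v2 - v1) <= c + t * h + 2^-1 * t ^+ 2 * (Q + s * D + e).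
Proof.
move=> t0 t2 tQ -> v2le.
have t1 : 0 < 1 - t by lra.
have kE : (1 - t) * k = t by rewrite mulrC divfK // gt_eqF.
have k0 : 0 < k by rewrite divr_gt0.
have k2 : k <= 2 * t by exact: convex_weight_le.
clearbody k.
have kQ : k * Q <= e.
  have := ler_wpM2l (ltW k0) (ler_norm Q).
  have := ler_wpM2r (normr_ge0 Q) k2.
  by have := mulr_ge0 (ltW t0) (normr_ge0 Q); lra.
have kh : (1 - t) * k * h = t * h by rewrite kE.
have kkQ : (1 - t) * k * k * Q = t * k * Q by rewrite kE.
have k_split : t * k * Q = t * t * Q + t * t * (k * Q).
  have {1}-> : k = t + t * k by lra.
  by ring.
have := ler_wpM2l (mulr_ge0 (ltW t0) (ltW t0)) kQ.
have := ler_wpM2l (ltW t0) v2le.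
by rewrite !expr2; lra.
Qed.

(** Bookkeeping for a recovery point: [v1], [v0] and [c0] are the values at the
    restored point, at its target and at the base point, [X] is the displacement
    made by the restoration and [dv] the pairing of the subgradient with it. *)
Lemma recovery_estimate tau c0 h0 Q sD e E cL K eta cv vu rr X dv v0 v1 :
  0 < tau -> 0 <= cv -> eta * (1 + cv) = e / 2 ->
  v1 <= v0 + tau * (cL * E + eta) -> v0 <= c0 + h0 + tau * (Q + sD + e / 2) ->
  sD <= rr -> X <= tau * (K * E + eta) -> - (cv * X) <= dv ->
  v1 - c0 - (h0 + tau * vu + dv) <= (Q + rr + (cL + cv * K) * E - vu + e) * tau.
Proof.
move=> tau0 cv0 etaE v1le v0le /(ler_wpM2l (ltW tau0)) le1.
move=> /(ler_wpM2l cv0) le2 dv_ge.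
have : tau * (eta * (1 + cv)) = tau * (e / 2) by rewrite etaE.
by lra.
Qed.

End ErrorTerms.

Section Restoration.
Context {R : realType}.
Variables (n m : nat) (theta : 'rV[R]_m -> \bar R) (f : 'rV[R]_n -> 'rV[R]_m).

Local Notation dom := (edom theta).
Local Notation th := (fun y => fine (theta y)).

(** The slack [e] accounts for distances that are not attained. *)
Definition restorable (K : R) x := forall y e, dom y -> 0 < e ->
  exists x', dom (f x') /\ `|x - x'| <= K * `|f x - y| + e.

Lemma MSQC_restorable xbar : MSQC theta f xbar ->
  exists2 K, 0 <= K & \forall x \near xbar, restorable K x.
Proof.
move=> [kappa k0 near_dist]; exists (kappa * m%:R); first by rewrite mulr_ge0.
apply: filterS near_dist => x le y e dy e0.
have : (dist x (f @^-1` dom) < (kappa * m%:R * `|f x - y| + e)%:E)%E.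
  apply: (le_lt_trans le); apply: (@le_lt_trans _ _ (kappa * enorm (f x - y))%:E).
    rewrite EFinM lee_wpmul2l ?lee_fin //.
    by apply: ereal_inf_lbound; exists y.
  rewrite lte_fin; apply: (@le_lt_trans _ _ (kappa * m%:R * `|f x - y|)).
    by rewrite -mulrA ler_wpM2l // enorm_le_norm.
  by rewrite ltrDl.
move=> /ereal_inf_lt[_ [x' dx' <-]]; rewrite lte_fin => /ltW lt.
by exists x'; split=> //; apply: le_trans (norm_le_enorm _) lt.
Qed.

(** At the scale [tau], a point whose image is [E]-close to the domain can be
    moved by about [K * E] into the feasible set, which changes the value of
    the composite by at most about [L * (1 + |J| * K) * E]. *)
Lemma restoration (K L E : R) (J : 'M[R]_(n, m)) (eta : R) :
  0 <= K -> 0 <= L -> 0 <= E -> 0 < eta ->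
  exists2 e, 0 < e & forall tau x0 y0,
    0 < tau -> restorable K x0 -> dom y0 -> `|f x0 - y0| <= tau * (E + e) ->
    (forall x', `|x' - x0| <= tau * (K * E + 1) -> dom (f x') ->
       `|f x' - f x0 - (x' - x0) *m J| <= tau * e /\
       th (f x') - th y0 <= L * `|f x' - y0|) ->
    exists x', [/\ dom (f x'), `|x' - x0| <= tau * (K * E + eta),
      `|x' - x0| <= tau * (K * E + 1) &
      th (f x') <= th y0 + tau * (L * (1 + n%:R * `|J| * K) * E + eta)].
Proof.
move=> K0 L0 E0 eta0.
pose cJ : R := n%:R * `|J|; have cJ0 : 0 <= cJ by rewrite mulr_ge0.
(* [S] collects the coefficients of [e] in all the estimates below. *)
pose S : R := 1 + (K + 1) + L * (2 + cJ * (K + 1)).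
have LcJ : 0 <= L * (2 + cJ * (K + 1)).
  by rewrite mulr_ge0 // addr_ge0 // mulr_ge0 // addr_ge0.
have S0 : 0 < S by rewrite /S; lra.
pose mu : R := Num.min 1 eta; have mu0 : 0 < mu by rewrite lt_min ltr01.
have mu1 : mu <= 1 by rewrite ge_min lexx.
have mue : mu <= eta by rewrite ge_min lexx orbT.
pose e := mu / S; have e0 : 0 < e by rewrite divr_gt0.
have eS : e * S = mu by rewrite divfK // gt_eqF.
clearbody e; exists e => // tau x0 y0 tau0 rest dy0 close ctrl.
have [x' [dx' xx']] := rest y0 (tau * e) dy0 (mulr_gt0 tau0 e0).
have e_small : e * (K + 1) <= mu.
  by rewrite -eS ler_pM2l // /S; lra.
have dist1 : `|x' - x0| <= tau * (K * E + e * (K + 1)).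
  rewrite distrC (le_trans xx') //.
  have := ler_wpM2l K0 close; lra.
have distmu : `|x' - x0| <= tau * (K * E + mu).
  by apply: le_trans dist1 _; rewrite ler_pM2l // lerD2l.
have dist2 : `|x' - x0| <= tau * (K * E + 1).
  by apply: le_trans distmu _; rewrite ler_pM2l // lerD2l.
have [approx lip] := ctrl x' dist2 dx'.
exists x'; split=> //.
  by apply: le_trans distmu _; rewrite ler_pM2l // lerD2l.
rewrite -lerBlDl; apply: (le_trans lip).
have fx' : `|f x' - y0| <= tau * e + cJ * (tau * (K * E + e * (K + 1)))
    + tau * (E + e).
  have -> : f x' - y0 = (f x' - f x0 - (x' - x0) *m J) + (x' - x0) *m J
      + (f x0 - y0).
    by rewrite subrK addrA subrK.
  apply: le_trans (ler_normD _ _) (lerD _ close).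
  apply: le_trans (ler_normD _ _) (lerD approx _).
  by apply: le_trans (mulmx_norm_le _ _) _; rewrite ler_wpM2l.
apply: le_trans (ler_wpM2l L0 fx') _.
have : e * (L * (2 + cJ * (K + 1))) <= eta.
  apply: le_trans mue; rewrite -eS ler_pM2l // /S; lra.
move=> /(ler_wpM2l (ltW tau0)); rewrite -/cJ; lra.
Qed.

End Restoration.

(** * Subgradients of the composite *)

Section Subgradients.
Context {R : realType}.
Variables (n m : nat) (phi : 'rV[R]_n -> \bar R)
  (theta : 'rV[R]_m -> \bar R) (f : 'rV[R]_n -> 'rV[R]_m).
Hypotheses (thetaNy : forall y, theta y != -oo%E)
  (theta_conv : econvex theta).

Local Notation dom := (edom theta).
Local Notation th := (fun y => fine (theta y)).

Variables (K L r : R) (ybar : 'rV[R]_m).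
Hypotheses (K0 : 0 <= K) (L0 : 0 <= L).
Hypothesis lip : forall y y', `|y - ybar| < r -> `|y' - ybar| < r ->
  dom y -> dom y' -> th y - th y' <= L * `|y - y'|.

(** The cost of a unit of residual: the increase of the composite value caused
    by the restoration, plus the pairing of [v] with the displacement. *)
Definition penalty beta (v : 'rV[R]_n) (J : 'M[R]_(n, m)) : R :=
  beta * (L * (1 + n%:R * `|J| * K)) + n%:R * `|v| * K.

Lemma penalty_ge0 beta v J : 0 <= beta -> 0 <= penalty beta v J.
Proof.
by move=> b0; rewrite /penalty addr_ge0 ?mulr_ge0 // addr_ge0 ?mulr_ge0.
Qed.

Section AtPoint.
Variables (x : 'rV[R]_n) (alpha beta : R) (v : 'rV[R]_n).
Hypotheses (df : differentiable f x)
  (near_good : \forall x' \near x, [/\ phi x' = theta (f x'),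
     restorable theta f K x' & `|f x' - ybar| < r])
  (phi_le : (phi x <= alpha%:E)%E)
  (beta0 : 0 <= beta)
  (normal : regular_normal_cone (epi phi) (epair x alpha) (epair v (- beta))).

Let dfx : dom (f x).
Proof.
rewrite /edom /=; have [<- _ _] := nbhs_singleton near_good.
exact: le_lt_trans phi_le (ltry _).
Qed.

(** On the feasible set the composite is Lipschitz, so nearby feasible points
    lift to points of the epigraph at a comparable distance. *)
Lemma regular_normal_subgradient e : 0 < e -> \forall x' \near x, dom (f x') ->
  dotp v (x' - x) <= beta * (th (f x') - th (f x)) + e * `|x' - x|.
Proof.
move=> e0; pose c : R := n%:R * `|'J f x| + 1; pose M := L * c.
have c0 : 0 <= c by rewrite /c addr_ge0 // mulr_ge0.
have M0 : 0 <= M by rewrite mulr_ge0.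
have M1 : 0 < 1 + M by rewrite ltr_wpDr.
have e1 : 0 < e / (1 + M) by rewrite divr_gt0.
have /nbhs_normP[rho /= rho0 Hrho] := regular_normal_near e1 normal.
have near_ball : \forall x' \near x, `|x - x'| < rho / (1 + M).
  by apply/nbhs_normP; exists (rho / (1 + M)) => //=; rewrite divr_gt0.
have := jacobian_near df ltr01; move: near_good near_ball.
apply: filterS3 => x' [phix' _ fx'r] xx' fx' dx'.
have fx_le : `|f x' - f x| <= c * `|x' - x|.
  have -> : f x' - f x = (f x' - f x - (x' - x) *m 'J f x)
      + (x' - x) *m 'J f x by rewrite subrK.
  apply: le_trans (ler_normD _ _) _.
  rewrite /c mulrDl addrC; apply: lerD => //; exact: mulmx_norm_le.
have [phix _ fxr] := nbhs_singleton near_good.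
have lip1 := lip fx'r fxr dx' dfx; have lip2 := lip fxr fx'r dfx dx'.
set D := th (f x') - th (f x).
have D_le : `|D| <= M * `|x' - x|.
  rewrite (distrC (f x)) in lip2; have := ler_wpM2l L0 fx_le.
  by rewrite ler_norml /D /M -mulrA; lra.
have epi' : epi phi (epair x' (alpha + D)).
  exists x', (alpha + D); split=> //.
  rewrite phix' (theta_fine thetaNy dx') lee_fin /D.
  by move: phi_le; rewrite phix (theta_fine thetaNy dfx) lee_fin; lra.
have diff : epair x' (alpha + D) - epair x alpha = epair (x' - x) D.
  by rewrite epairB; congr epair; ring.
have norm_diff : `|epair (x' - x) D| <= (1 + M) * `|x' - x|.
  by apply: le_trans (norm_epair _ _) _; rewrite mulrDl mul1r lerD2l.
have := Hrho (epair x' (alpha + D)); rewrite /ball_ /= distrC diff dotp_epair.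
have -> : `|epair (x' - x) D| < rho.
  apply: le_lt_trans norm_diff _; rewrite mulrC -ltr_pdivlMr //.
  by rewrite distrC.
move=> /(_ isT epi') le.
have : e / (1 + M) * `|epair (x' - x) D| <= e * `|x' - x|.
  by rewrite mulrAC ler_pdivrMr // -mulrA ler_wpM2l ?(ltW e0) // mulrC.
by lra.
Qed.

(** The image of [x + t *: u] misses the point [f x + t *: (y' - f x)] of the
    domain by about [t] times the residual. Restore feasibility, bound the value
    by convexity, apply the normality of [v] and divide by [t]. *)
Lemma penalized_subgradient_at u y' : dom y' ->
  dotp v u <= beta * (th y' - th (f x))
    + penalty beta v ('J f x) * `|u *m 'J f x - (y' - f x)|.
Proof.
move=> dy'; set J := 'J f x; set E := `|u *m J - (y' - f x)|.
have E0 : 0 <= E by rewrite /E.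
pose cv : R := n%:R * `|v|; have cv0 : 0 <= cv by rewrite mulr_ge0.
pose S : R := beta + 1 + cv; have S0 : 0 < S by rewrite /S ltr_wpDr // ltr_wpDl.
apply/ler_addgt0Pr => e e0.
pose eta : R := e / S; have eta0 : 0 < eta by rewrite divr_gt0.
have etaS : eta * S = e by rewrite divfK // gt_eqF.
clearbody eta.
have [e' e'0 rest] := restoration theta f J K0 L0 E0 eta0.
pose B : R := `|u| + (K * E + 1).
have B0 : 0 < B by rewrite /B ltr_wpDl // ltr_wpDl // mulr_ge0.
have e1 : 0 < e' / 2 / B by rewrite !divr_gt0.
have e2 : 0 < eta / B by rewrite divr_gt0.
have /nbhs_normP[rho /= rho0 Hrho] : \forall x' \near x,
    [/\ restorable theta f K x', `|f x' - ybar| < r,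
        `|f x' - f x - (x' - x) *m J| <= e' / 2 / B * `|x' - x| &
        dom (f x') -> dotp v (x' - x) <=
          beta * (th (f x') - th (f x)) + eta / B * `|x' - x|].
  have := regular_normal_subgradient e2; have := jacobian_near df e1.
  by move: near_good; apply: filterS3 => x' [].
have [_ _ fxr] := nbhs_singleton near_good.
have y0_near : \forall t \near 0^'+, `|f x + t *: (y' - f x) - ybar| < r.
  exact: (segment_cvg (f x) (y' - f x) _ (near_in_ball fxr)).
near (0 : R)^'+ => t.
have t0 : 0 < t by near: t; exact: nbhs_right_gt.
have t1 : t <= 1 by near: t; exact: nbhs_right_le.
have tB : t * B < rho.
  by rewrite -ltr_pdivlMr //; near: t; apply: nbhs_right_lt; rewrite divr_gt0.
pose x0 := x + t *: u; pose y0 := f x + t *: (y' - f x).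
have dy0 : dom y0 by apply: (dom_segment thetaNy theta_conv); rewrite ?ltW.
have y0r : `|y0 - ybar| < r by rewrite /y0; near: t.
have close x' : `|x' - x| <= t * B ->
    [/\ restorable theta f K x', `|f x' - ybar| < r,
        `|f x' - f x - (x' - x) *m J| <= t * (e' / 2) &
        dom (f x') -> dotp v (x' - x) <=
          beta * (th (f x') - th (f x)) + t * eta].
  move=> x'B; have [] := Hrho x'.
    by rewrite /ball_ /= distrC (le_lt_trans x'B).
  move=> h1 h2 h3 h4; split=> //.
    apply: le_trans h3 _; rewrite mulrAC ler_pdivrMr //.
    have -> : t * (e' / 2) * B = e' / 2 * (t * B) by ring.
    by rewrite ler_wpM2l // divr_ge0 // ltW.
  move=> /h4 le; apply: le_trans le _; rewrite lerD2l mulrAC ler_pdivrMr //.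
  have -> : t * eta * B = eta * (t * B) by ring.
  by rewrite ler_wpM2l // ltW.
have x0x : x0 - x = t *: u by rewrite /x0 addrC addKr.
have x0B : `|x0 - x| <= t * B.
  by rewrite x0x normrZ gtr0_norm // ler_pM2l // /B lerDl addr_ge0 // mulr_ge0.
have [rest0 _ jac0 _] := close x0 x0B.
have near_B x' : `|x' - x0| <= t * (K * E + 1) -> `|x' - x| <= t * B.
  move=> le; have -> : x' - x = (x' - x0) + t *: u by rewrite -x0x addrA subrK.
  apply: le_trans (ler_normD _ _) _.
  by rewrite normrZ gtr0_norm // /B mulrDr addrC lerD2l.
have close0 : `|f x0 - y0| <= t * (E + e').
  have -> : f x0 - y0 = (f x0 - f x - (x0 - x) *m J)
      + t *: (u *m J - (y' - f x)).
    by rewrite x0x -scalemxAl scalerBr /y0 opprD !addrA subrK.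
  apply: le_trans (ler_normD _ _) _; rewrite normrZ gtr0_norm // -/E.
  have : 0 < t * e' by rewrite mulr_gt0.
  by lra.
have [|x' [dx' x'x0 x'1 val]] := rest t x0 y0 t0 rest0 dy0 close0.
  move=> x' /near_B/close[_ x'r jac' _] dx'; split; last exact: lip.
  have -> : f x' - f x0 - (x' - x0) *m J = (f x' - f x - (x' - x) *m J)
      - (f x0 - f x - (x0 - x) *m J).
    have -> : x' - x0 = (x' - x) - (x0 - x) by rewrite opprB addrA subrK.
    by rewrite mulmxBl; apply/rowP => i; rewrite !mxE; ring.
  by apply: le_trans (ler_normB _ _) _; lra.
have [_ _ _ /(_ dx') sub] := close x' (near_B _ x'1).
have := dotp_ge v (x' - x0); rewrite -/cv => dge.
have v_split : dotp v (x' - x) = t * dotp v u + dotp v (x' - x0).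
  rewrite -dotpZr -dotpDr; congr dotp.
  by rewrite -x0x [RHS]addrC addrA subrK.
have th0 := th_segment thetaNy theta_conv dfx dy' (t := t).
have {}th0 : th y0 <= th (f x) + t * (th y' - th (f x)).
  by apply: th0; rewrite t1 ltW.
rewrite -(ler_pM2l t0).
have := ler_wpM2l cv0 x'x0; have := ler_wpM2l beta0 val.
have := ler_wpM2l beta0 th0.
move: sub; rewrite v_split /penalty -/cv -etaS /S -/J -/E /= => sub h1 h2 h3.
by lra.
Unshelve. all: by end_near. Qed.

End AtPoint.

Variable xbar : 'rV[R]_n.
Hypotheses (dybar : dom (f xbar)) (yE : ybar = f xbar) (r0 : 0 < r).
Hypotheses (td : twice_differentiable f xbar)
  (phiE : \forall x \near xbar, phi x = theta (f x))
  (rest : \forall x \near xbar, restorable theta f K x).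

Lemma near_good_point : \forall x \near xbar, [/\ phi x = theta (f x),
     restorable theta f K x & `|f x - ybar| < r].
Proof.
have [df _] := td.
have fr : \forall x \near xbar, `|f x - ybar| < r.
  have fcont := differentiable_continuous (nbhs_singleton df).
  by apply: (fcont _ (near_in_ball _)); rewrite yE subrr normr0.
by move: phiE rest fr; apply: filterS3.
Qed.

(** The inequality holds at the points carrying the approximating normals, and
    its data converge. *)
Lemma penalized_subgradient vbar u y' :
  subdifferential phi xbar vbar -> dom y' ->
  dotp vbar u <= th y' - th (f xbar)
    + penalty 1 vbar ('J f xbar) * `|u *m 'J f xbar - (y' - f xbar)|.
Proof.
move=> [_ [xk [vk [xepi vN xlim vlim]]]] dy'.
have [df dJ] := td.
pose X k := lsubmx (xk k); pose al k := rsubmx (xk k) ord0 ord0.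
pose V k := lsubmx (vk k); pose beta k := - rsubmx (vk k) ord0 ord0.
have Xlim : X k @[k --> \oo] --> xbar.
  by rewrite -(lsubmx_epair xbar (fine (phi xbar))); exact: cvg_lsubmx.
have Vlim : V k @[k --> \oo] --> vbar.
  by rewrite -(lsubmx_epair vbar (-1)); exact: cvg_lsubmx.
have blim : beta k @[k --> \oo] --> (1 : R).
  rewrite -[X in _ --> X]opprK; apply: cvgN.
  by rewrite -(rsubmx_epair vbar (-1)); exact: cvg_rsubmx.
have flim : f (X k) @[k --> \oo] --> f xbar.
  apply: (cvg_comp X f Xlim).
  exact: (differentiable_continuous (nbhs_singleton df)).
have Jlim : 'J f (X k) @[k --> \oo] --> 'J f xbar.
  apply: (cvg_comp X (fun y => 'J f y) Xlim).
  exact: (differentiable_continuous dJ).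
have phiX k : (phi (X k) <= (al k)%:E)%E.
  by have [x [a [zE le]]] := xepi k; rewrite /X /al zE lsubmx_epair rsubmx_epair.
have good : \forall k \near \oo, \forall x' \near X k, [/\ phi x' = theta (f x'),
     restorable theta f K x' & `|f x' - ybar| < r].
  exact: (Xlim _ (nbhs_interior near_good_point)).
have bpos : \forall k \near \oo, 0 <= beta k.
  exact: (cvgr_ge _ blim).
have dfX : \forall k \near \oo, differentiable f (X k) by exact: (Xlim _ df).
have domX : \forall k \near \oo, dom (f (X k)).
  move: good; apply: filterS => k /nbhs_singleton[phik _ _].
  rewrite /edom /= -phik; exact: le_lt_trans (phiX k) (ltry _).
have thlim : th (f (X k)) @[k --> \oo] --> th (f xbar).
  apply/cvgrPdist_le => e e0.
  have L1 : 0 < L + 1 by rewrite ltr_wpDl.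
  have /cvgrPdist_le/(_ (e / (L + 1))) := flim.
  rewrite divr_gt0 // => /(_ isT); move: good domX.
  apply: filterS3 => k /nbhs_singleton[_ _ fkr] dk.
  rewrite ler_pdivlMr // => le.
  have fxr : `|f xbar - ybar| < r by rewrite yE subrr normr0.
  have := lip fkr fxr dk dybar; have := lip fxr fkr dybar dk.
  rewrite (distrC (f (X k))) ler_norml /= => l1 l2.
  have : 0 <= `|f xbar - f (X k)| by [].
  lra.
have ineq : \forall k \near \oo, dotp (V k) u <=
    beta k * (th y' - th (f (X k))) + penalty (beta k) (V k) ('J f (X k)) *
      `|u *m 'J f (X k) - (y' - f (X k))|.
  near=> k.
  apply: (@penalized_subgradient_at (X k) (al k)) => //; try by near: k.
  have := vN k; rewrite -{1}(epairK (xk k)) -{1}(epairK (vk k)).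
  by rewrite /beta opprK.
have lhs : dotp (V k) u @[k --> \oo] --> dotp vbar u.
  by apply: cvg_dotp => //; exact: cvg_cst.
have penlim : penalty (beta k) (V k) ('J f (X k)) @[k --> \oo] -->
    penalty 1 vbar ('J f xbar).
  apply: cvgD.
    apply: cvgM => //; apply: cvgM; first exact: cvg_cst.
    apply: cvgD; first exact: cvg_cst.
    apply: cvgM; last exact: cvg_cst.
    by apply: cvgM; [exact: cvg_cst|exact: cvg_norm].
  apply: cvgM; last exact: cvg_cst.
  by apply: cvgM; [exact: cvg_cst|exact: cvg_norm].
have rhs : beta k * (th y' - th (f (X k))) + penalty (beta k) (V k) ('J f (X k)) *
      `|u *m 'J f (X k) - (y' - f (X k))| @[k --> \oo] -->
    1 * (th y' - th (f xbar)) + penalty 1 vbar ('J f xbar) *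
      `|u *m 'J f xbar - (y' - f xbar)|.
  apply: cvgD.
    by apply: cvgM => //; apply: cvgB => //; exact: cvg_cst.
  apply: cvgM => //; apply: cvg_norm; apply: cvgB; first exact: cvg_mulmxr.
  by apply: cvgB => //; exact: cvg_cst.
by rewrite -[X in _ <= X + _]mul1r; exact: (ler_cvg_to lhs rhs ineq).
Unshelve. all: by end_near. Qed.

(** Composing a difference quotient of the outer function with the expansion
    of the inner one only shifts it by the curvature term. *)
Lemma second_subderivative_comp_ge lambda vbar w :
  lambda *m ('J f xbar)^T = vbar ->
  (second_subderivative theta (f xbar) lambda (w *m 'J f xbar)
   + (dotp lambda (second_derivative f xbar w w))%:E
   <= second_subderivative phi xbar vbar w)%E.
Proof.
move=> lamE; set J := 'J f xbar; set z := second_derivative f xbar w w.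
set a := w *m J.
suff real_le (c : R) :
    (c%:E < second_subderivative theta (f xbar) lambda a)%E ->
    ((c + dotp lambda z)%:E <= second_subderivative phi xbar vbar w)%E.
  move: real_le; case: (second_subderivative theta _ _ _) => [d||] real_le.
  - apply/lee_subgt0Pr => e e0.
    have := real_le (d - e); rewrite lte_fin gtrBl e0 => /(_ isT).
    by rewrite addrAC.
  - suff -> : second_subderivative phi xbar vbar w = +oo%E by rewrite leey.
    apply/eqyP => c _; have := real_le (c - dotp lambda z) (ltry _).
    by rewrite subrK.
  - by rewrite addNye leNye.
move=> /limf_einf_gt near_c.
apply/lee_subgt0Pr => e e0; rewrite -EFinB; apply: limf_einf_ge.
pose N : R := m%:R * `|lambda|; have N0 : 0 <= N by rewrite mulr_ge0.
pose e1 : R := e / 2 / (N + 1).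
have N1 : 0 < N + 1 by rewrite ltr_wpDl.
have e10 : 0 < e1 by rewrite !divr_gt0.
(* The direction of the outer quotient that matches the step of the inner
   one. *)
pose Y (p : R * 'rV[R]_n) := p.1^-1 *: (f (xbar + p.1 *: p.2) - f xbar).
have tay := taylor2_ray w td e10.
have t_gt0 := near_fst w (nbhs_right_gt (0 : R)).
have Ylim : Y @ filter_prod (0 : R)^'+ (nbhs w) --> a.
  apply/cvgrPdist_le => d d0.
  have d2 : 0 < d / 2 by rewrite divr_gt0.
  have k0 : 0 < e1 + `|z| by rewrite ltr_wpDr.
  have t_small : \forall p \near filter_prod (0 : R)^'+ (nbhs w),
      0 < p.1 /\ p.1 * (e1 + `|z|) <= d / 2.
    apply: (near_fst w (P := fun t => 0 < t /\ t * (e1 + `|z|) <= d / 2)).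
    near=> t; split; first by near: t; exact: nbhs_right_gt.
    rewrite -ler_pdivlMr //; near: t; apply: nbhs_right_le.
    by rewrite divr_gt0.
  have uJ : \forall p \near filter_prod (0 : R)^'+ (nbhs w),
      `|a - p.2 *m J| <= d / 2.
    apply: (near_snd (P := fun u => `|a - u *m J| <= d / 2)).
    have uJ : u *m J @[u --> w] --> a by exact: (@cvg_mulmx _ _ (nbhs w) _ _ id).
    by move/cvgrPdist_le : uJ; exact.
  move: tay t_small uJ; apply: filterS3 => -[t u] /= tayt [t0 tk] uJ.
  have -> : a - Y (t, u) = (a - u *m J) + (u *m J - Y (t, u)).
    by rewrite addrA subrK.
  apply: le_trans (ler_normD _ _) _; rewrite [leRHS]splitr; apply: lerD => //.
  apply: le_trans tk; rewrite -(ler_pM2l t0) -{1}(gtr0_norm t0) -normrZ.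
  have -> : t *: (u *m J - Y (t, u)) =
      - (f (xbar + t *: u) - f xbar - t *: (u *m J) - (2^-1 * t ^+ 2) *: z)
      - (2^-1 * t ^+ 2) *: z.
    rewrite opprB scalerBr /Y /= scalerA divff ?gt_eqF // scale1r.
    by apply/rowP => i; rewrite !mxE; ring.
  apply: le_trans (ler_normB _ _) _; rewrite normrN normrZ.
  have t20 : 0 < t ^+ 2 by rewrite exprn_gt0.
  rewrite (@gtr0_norm _ (2^-1 * t ^+ 2)) ?mulr_gt0 ?invr_gt0 //.
  have : 0 <= t ^+ 2 * `|z| by rewrite mulr_ge0 // ltW.
  by move: tayt; rewrite !expr2; lra.
have YF : (fun p => (p.1, Y p)) @ filter_prod (0 : R)^'+ (nbhs w) -->
    filter_prod (0 : R)^'+ (nbhs a) by exact: cvg_pair cvg_fst Ylim.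
have {}near_c : \forall p \near filter_prod (0 : R)^'+ (nbhs w),
    (c%:E <= second_quotient theta (f xbar) lambda p.1 (Y p))%E.
  exact: (YF _ near_c).
have near_phi : \forall p \near filter_prod (0 : R)^'+ (nbhs w),
    phi (xbar + p.1 *: p.2) = theta (f (xbar + p.1 *: p.2)).
  exact: (ray_cvg xbar w _ phiE).
have tay_t : \forall p \near filter_prod (0 : R)^'+ (nbhs w), 0 < p.1 /\
    `|f (xbar + p.1 *: p.2) - f xbar - p.1 *: (p.2 *m J)
      - (2^-1 * p.1 ^+ 2) *: z| <= e1 * p.1 ^+ 2.
  by move: t_gt0 tay; apply: filterS2.
move: near_c near_phi tay_t.
apply: filterS3 => -[t u] /= near_c phit [t0 tayt].
have phix : phi xbar = (th (f xbar))%:E.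
  by rewrite (nbhs_singleton phiE) (theta_fine thetaNy).
have YE : f xbar + t *: Y (t, u) = f (xbar + t *: u).
  by rewrite /Y /= scalerA divff ?gt_eqF // scale1r addrC subrK.
have [dt|/notin_dom nd] := pselect (dom (f (xbar + t *: u))); last first.
  by rewrite (second_quotient_pinfty _ t0 phix) ?leey // phit.
have thf := theta_fine thetaNy dt.
rewrite (second_quotient_fin _ phix (etrans phit thf)) lee_fin.
have t20 : 0 < 2^-1 * t ^+ 2 by rewrite mulr_gt0 ?invr_gt0 // exprn_gt0.
move: near_c; rewrite (second_quotient_fin _ (theta_fine thetaNy dybar)
  (etrans (congr1 theta YE) thf)) lee_fin !ler_pdivlMr //.
have -> : dotp vbar u = dotp lambda (u *m J).
  by rewrite -lamE dotp_mulmx trmxK.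
have lam_rem := dotp_ge lambda (f (xbar + t *: u) - f xbar - t *: (u *m J)
  - (2^-1 * t ^+ 2) *: z).
have rem : N * `|f (xbar + t *: u) - f xbar - t *: (u *m J)
  - (2^-1 * t ^+ 2) *: z| <= e / 2 * t ^+ 2.
  apply: le_trans (ler_wpM2l N0 tayt) _; rewrite mulrA ler_wpM2r ?sqr_ge0 //.
  rewrite /e1 mulrA ler_pdivrMr // mulrC ler_wpM2l ?lerDl //.
  by rewrite divr_ge0 // ltW.
have tY : t * dotp lambda (Y (t, u)) = dotp lambda (f (xbar + t *: u) - f xbar).
  by rewrite -dotpZr -YE (addrC (f xbar)) addrK.
move: lam_rem rem; rewrite -/N tY !dotpBr !dotpZr /=.
by lra.
Unshelve. all: by end_near. Qed.

(** The point [y0] is a convex combination of a point of the quadratic ray, at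
    the step [t / (1 - t)], and of a point of the segment towards [y']. *)
Lemma parabolic_value a h Q y' s : dom y' -> 0 <= s ->
  (\forall t \near 0^'+, theta (f xbar + t *: a) =
     (th (f xbar) + t * h + 2^-1 * t ^+ 2 * Q)%:E) ->
  forall e, 0 < e -> \forall t \near 0^'+,
    let y0 := f xbar + t *: a + (2^-1 * t ^+ 2 * s) *: (y' - f xbar) in
    dom y0 /\ th y0 <= th (f xbar) + t * h +
      2^-1 * t ^+ 2 * (Q + s * (th y' - th (f xbar)) + e).
Proof.
move=> dy' s0 /near_at_right0[rq rq0 quad] e e0.
have Q0 : 0 < 4 * (`|Q| + 1) by rewrite mulr_gt0 // ltr_wpDl.
near=> t; set y0 := f xbar + _ + _.
have t0 : 0 < t by near: t; exact: nbhs_right_gt.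
have t2 : t <= 2^-1 by near: t; apply: nbhs_right_le; rewrite invr_gt0.
have trq : 2 * t < rq.
  rewrite mulrC -ltr_pdivlMr //; near: t; apply: nbhs_right_lt.
  by rewrite divr_gt0.
have ts : t * (s + 1) <= 2.
  rewrite -ler_pdivlMr ?ltr_wpDl //; near: t; apply: nbhs_right_le.
  by rewrite divr_gt0 // ltr_wpDl.
have tQ : t * (4 * (`|Q| + 1)) <= e.
  by rewrite -ler_pdivlMr //; near: t; apply: nbhs_right_le; rewrite divr_gt0.
have t1 : 0 < 1 - t by rewrite subr_gt0 (le_lt_trans t2) // invf_lt1 ?ltr1n.
pose k : R := t / (1 - t).
have kE : (1 - t) * k = t by rewrite mulrC divfK // gt_eqF.
have k0 : 0 < k by rewrite divr_gt0.
have k2 := convex_weight_le t0 t2.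
have th1 := quad k k0 (le_lt_trans k2 trq).
pose y1 := f xbar + k *: a; pose y2 := f xbar + (t * s / 2) *: (y' - f xbar).
have dy1 : dom y1 by rewrite /edom /= th1 ltry.
have ts01 : 0 <= t * s / 2 <= 1.
  rewrite divr_ge0 ?mulr_ge0 ?(ltW t0) //= ler_pdivrMr // mul1r.
  by apply: le_trans ts; rewrite ler_pM2l // lerDl.
have dy2 : dom y2 by exact: dom_segment.
have t01 : 0 <= t <= 1 by rewrite (ltW t0) -subr_ge0 ltW.
have y0E : y0 = y1 + t *: (y2 - y1).
  rewrite /y0 /y1 /y2; apply/rowP => i; rewrite !mxE -{1}kE expr2.
  by field.
split; first by rewrite y0E; exact: dom_segment.
have := th_segment thetaNy theta_conv dy1 dy2 t01; rewrite -y0E.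
have := th_segment thetaNy theta_conv dybar dy' ts01; rewrite -/y2 => le2 le0.
apply: (le_trans le0); rewrite /= th1 /=.
exact: convex_combination_expansion.
Unshelve. all: by end_near. Qed.

(** The arc [xbar + t *: w + (t ^+ 2 / 2) *: u] is restored onto a point whose
    image is close to the parabola of [parabolic_value]; the gap between the two
    images is the residual charged by the penalty. *)
Lemma parabolic_recovery vbar w Q u y' s rr e : dom y' -> 0 <= s ->
  s * (th y' - th (f xbar)) <= rr -> 0 < e ->
  (\forall t \near 0^'+, theta (f xbar + t *: (w *m 'J f xbar)) =
     (th (f xbar) + t * dotp vbar w + 2^-1 * t ^+ 2 * Q)%:E) ->
  \forall t \near 0^'+, exists w', `|w' - w| < e /\
    (second_quotient phi xbar vbar t w' <=
     (Q + rr + penalty 1 vbar ('J f xbar) *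
        `|u *m 'J f xbar + second_derivative f xbar w w - s *: (y' - f xbar)|
      - dotp vbar u + e)%:E)%E.
Proof.
move=> dy' s0 le_rr e0 quad.
set J := 'J f xbar; set z := second_derivative f xbar w w.
set d := s *: (y' - f xbar); set E := `|u *m J + z - d|.
pose a := w *m J.
have E0 : 0 <= E by rewrite /E.
pose cv : R := n%:R * `|vbar|; have cv0 : 0 <= cv by rewrite mulr_ge0.
have cv1 : 0 < 1 + cv by rewrite ltr_wpDr.
pose eta : R := e / 2 / (1 + cv).
have eta0 : 0 < eta by rewrite !divr_gt0.
have etaE : eta * (1 + cv) = e / 2 by rewrite divfK // gt_eqF.
clearbody eta.
have [e' e'0 restore] := restoration theta f J K0 L0 E0 eta0.
have e2 : 0 < e / 2 by rewrite divr_gt0.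
have par := parabolic_value dy' s0 quad e2.
pose B : R := `|u| + (K * E + 1).
have B0 : 0 < B by rewrite /B ltr_wpDl // ltr_wpDl // mulr_ge0.
(* Half of the tolerance [e'] at the scale [tau = t ^+ 2 / 2]. *)
have e4 : 0 < e' / 4 by rewrite divr_gt0.
have [[PA PB] /= [/near_at_right0[rt rt0 Prt] /nbhs_normP[rw rw0 Prw]] Ptay] :=
  taylor2_ray w td e4.
have /nbhs_normP[rho /= rho0 Hrho] := near_good_point.
pose mu : R := Num.min (Num.min 1 e) rw.
have mu0 : 0 < mu by rewrite !lt_min ltr01 e0.
have w1 : 0 < `|w| + 1 by rewrite ltr_wpDl.
have ad0 : 0 < `|a| + `|d| + 1 by rewrite ltr_wpDl // addr_ge0.
near=> t.
have t0 : 0 < t by near: t; exact: nbhs_right_gt.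
have trt : t < rt by near: t; exact: nbhs_right_lt.
have tB : t * B < mu.
  by rewrite -ltr_pdivlMr //; near: t; apply: nbhs_right_lt; rewrite divr_gt0.
have trho : t * (`|w| + 1) < rho.
  by rewrite -ltr_pdivlMr //; near: t; apply: nbhs_right_lt; rewrite divr_gt0.
pose tau : R := 2^-1 * t ^+ 2.
have tau0 : 0 < tau by rewrite mulr_gt0 ?invr_gt0 // exprn_gt0.
pose y0 := f xbar + t *: a + (tau * s) *: (y' - f xbar).
have [dy0 th0] : dom y0 /\ th y0 <= th (f xbar) + t * dotp vbar w +
    tau * (Q + s * (th y' - th (f xbar)) + e / 2).
  by rewrite /y0 /tau; near: t.
have t1 : t <= 1 by near: t; exact: nbhs_right_le.
have tr : t * (`|a| + `|d| + 1) < r.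
  by rewrite -ltr_pdivlMr //; near: t; apply: nbhs_right_lt; rewrite divr_gt0.
have y0r : `|y0 - ybar| < r.
  have -> : y0 - ybar = t *: (a + (t / 2) *: d).
    by rewrite /y0 yE /d /tau; apply/rowP => i; rewrite !mxE; field.
  apply: le_lt_trans tr; rewrite normrZ gtr0_norm // ler_pM2l //.
  apply: le_trans (ler_normD _ _) _; rewrite normrZ gtr0_norm ?divr_gt0 //.
  rewrite -addrA lerD2l (le_trans (ler_piMl _ _)) ?lerDl //.
  by rewrite ler_pdivrMr // mul1r (le_trans t1) // ler1n.
pose w0 := w + (t / 2) *: u; pose x0 := xbar + t *: w0.
have x0E : x0 = xbar + t *: w + tau *: u.
  by rewrite /x0 /w0 /tau; apply/rowP => i; rewrite !mxE; field.
(* The direction that leads from [xbar] to [x'] in a step [t]. *)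
pose dir x' := t^-1 *: (x' - xbar).
have dirE x' : xbar + t *: dir x' = x'.
  by rewrite /dir scalerA divff ?gt_eqF // scale1r addrC subrK.
have near_x x' : `|x' - x0| <= tau * (K * E + 1) ->
    [/\ `|dir x' - w| < mu, restorable theta f K x', phi x' = theta (f x'),
        `|f x' - ybar| < r &
        `|f x' - f xbar - (x' - xbar) *m J - tau *: z| <= tau * (e' / 2)].
  move=> x'x0.
  have dir_w : `|dir x' - w| < mu.
    apply: le_lt_trans tB.
    have -> : dir x' - w = t^-1 *: ((x' - x0) + tau *: u).
      have -> : x' - x0 + tau *: u = x' - xbar - t *: w.
        by rewrite x0E; apply/rowP => i; rewrite !mxE; ring.
      by rewrite /dir [RHS]scalerBr scalerA mulVf ?gt_eqF // scale1r.
    rewrite normrZ gtr0_norm ?invr_gt0 // ler_pdivrMl //.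
    apply: le_trans (ler_normD _ _) _; rewrite normrZ gtr0_norm //.
    have -> : t * (t * B) = tau * B + tau * B by rewrite /tau expr2; field.
    apply: (@le_trans _ _ (tau * B)); last by rewrite lerDl mulr_ge0 // ltW.
    by rewrite /B mulrDr addrC lerD2l.
  have [|gphi grest gr] := Hrho x'.
    apply: le_lt_trans trho; rewrite distrC -{1}(dirE x') addrC addKr normrZ.
    rewrite gtr0_norm // ler_pM2l // -(subrK w (dir x')) addrC.
    rewrite (le_trans (ler_normD _ _)) // lerD2l (le_trans (ltW dir_w)) //.
    by rewrite /mu !ge_min lexx.
  split=> //.
  have Pt : PA t /\ PB (dir x').
    split; first exact: Prt.
    apply: Prw; rewrite /ball_ /= distrC; apply: lt_le_trans dir_w _.
    by rewrite /mu ge_min lexx orbT.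
  have := Ptay (t, dir x') Pt; rewrite /= dirE -/J -/z -/tau.
  rewrite scalemxAl {1}/dir scalerA divff ?gt_eqF // scale1r => le.
  apply: (le_trans le); suff -> : tau * (e' / 2) = e' / 4 * t ^+ 2 by [].
  by rewrite /tau; field.
have x00 : `|x0 - x0| <= tau * (K * E + 1).
  by rewrite subrr normr0 mulr_ge0 ?(ltW tau0) // addr_ge0 // mulr_ge0.
have [_ rest0 _ _ tay0] := near_x x0 x00.
have close0 : `|f x0 - y0| <= tau * (E + e').
  have -> : f x0 - y0 = (f x0 - f xbar - (x0 - xbar) *m J - tau *: z)
      + tau *: (u *m J + z - d).
    rewrite x0E -addrA (addrC xbar) addrK mulmxDl -!scalemxAl /y0 /d /a.
    by apply/rowP => i; rewrite !mxE; ring.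
  apply: le_trans (ler_normD _ _) _; rewrite normrZ gtr0_norm // -/E.
  rewrite mulrDr addrC lerD2l (le_trans tay0) // ler_pM2l //.
  by rewrite ler_pdivrMr // ler_peMr ?(ltW e'0) // ler1n.
have [|x' [dx' x'x0 x'1 val]] := restore tau x0 y0 tau0 rest0 dy0 close0.
  move=> x' /near_x[_ _ _ x'r tayx'] dx'; split; last exact: lip.
  have -> : f x' - f x0 - (x' - x0) *m J =
      (f x' - f xbar - (x' - xbar) *m J - tau *: z)
      - (f x0 - f xbar - (x0 - xbar) *m J - tau *: z).
    have -> : x' - x0 = (x' - xbar) - (x0 - xbar) by rewrite opprB addrA subrK.
    by rewrite mulmxBl; apply/rowP => i; rewrite !mxE; ring.
  apply: le_trans (ler_normB _ _) _; rewrite [e']splitr mulrDr.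
  exact: lerD.
have [dir_w _ phix' _ _] := near_x x' x'1.
exists (dir x'); split.
  by apply: lt_le_trans dir_w _; rewrite /mu !ge_min lexx orbT.
have phix : phi xbar = (th (f xbar))%:E.
  by rewrite (nbhs_singleton phiE) (theta_fine thetaNy).
have phit : phi (xbar + t *: dir x') = (th (f x'))%:E.
  by rewrite dirE phix' (theta_fine thetaNy dx').
rewrite (second_quotient_fin _ phix phit) lee_fin ler_pdivrMr // -/tau.
have v_split : t * dotp vbar (dir x') =
    t * dotp vbar w + tau * dotp vbar u + dotp vbar (x' - x0).
  rewrite -!dotpZr -!dotpDr; congr dotp; rewrite /dir scalerA divff ?gt_eqF //.
  by rewrite scale1r x0E; apply/rowP => i; rewrite !mxE; ring.
rewrite v_split /penalty mul1r -/cv -/J -/E.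
apply: (recovery_estimate _ tau0 cv0 etaE val th0 le_rr x'x0).
exact: dotp_ge.
Unshelve. all: by end_near. Qed.

End Subgradients.

(** * The chain rule *)

Section EpigraphCone.
Context {R : realType}.
Variables (m : nat) (theta : 'rV[R]_m -> \bar R) (ybar : 'rV[R]_m).
Hypotheses (thetaNy : forall y, theta y != -oo%E)
  (theta_conv : econvex theta) (dybar : edom theta ybar).

Local Notation th := (fun y => fine (theta y)).

(** The cone generated by the epigraph seen from [(ybar, theta ybar)]. *)
Definition epigraph_cone : set ('rV[R]_m * R) :=
  [set g | exists s y, [/\ 0 <= s, edom theta y, g.1 = s *: (y - ybar)
                         & s * (th y - th ybar) <= g.2]].

Lemma epigraph_cone_convex : convex_cone epigraph_cone.
Proof.
split.
- by exists 0, ybar; rewrite /= scale0r mul0r; split.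
- move=> [d1 r1] [d2 r2] [s1 [y1 [s10 dy1 /= -> le1]]].
  move=> [s2 [y2 [s20 dy2 /= -> le2]]].
  have [s0|sN0] := eqVneq (s1 + s2) 0.
    have [s1E s2E] : s1 = 0 /\ s2 = 0 by split; lra.
    exists 0, ybar; rewrite s1E s2E !scale0r addr0 mul0r; split=> //.
    by move: le1 le2; rewrite s1E s2E !mul0r /=; lra.
  have s0 : 0 < s1 + s2 by rewrite lt_def sN0 addr_ge0.
  have t01 : 0 <= s2 / (s1 + s2) <= 1.
    by rewrite divr_ge0 ?(ltW s0) //= ler_pdivrMr // mul1r lerDr.
  exists (s1 + s2), (y1 + (s2 / (s1 + s2)) *: (y2 - y1)); split.
  + exact: ltW.
  + exact: dom_segment.
  + by rewrite /=; apply/rowP => i; rewrite !mxE; field.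
  + have h := ler_wpM2l (ltW s0) (th_segment thetaNy theta_conv dy1 dy2 t01).
    have eq : (s1 + s2) * (s2 / (s1 + s2) * (th y2 - th y1)) =
              s2 * (th y2 - th y1) by field.
    by move: h le1 le2; rewrite mulrDr eq /=; lra.
- move=> k [d r] k0 [s [y [s0 dy /= -> le]]].
  exists (k * s), y; rewrite mulr_ge0 // ?(ltW k0) //=; split=> //.
    by rewrite scalerA.
  by rewrite -mulrA ler_pM2l.
Qed.

End EpigraphCone.

Section ChainRule.
Context {R : realType}.
Variables (n m : nat) (phi : 'rV[R]_n -> \bar R) (xbar : 'rV[R]_n)
  (theta : 'rV[R]_m -> \bar R) (f : 'rV[R]_n -> 'rV[R]_m).
Hypotheses (xbar_dom : edom phi xbar)
  (phi_sub : fully_subamenable_with phi xbar theta f).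
Variable vbar : 'rV[R]_n.
Hypothesis vbar_sub : subdifferential phi xbar vbar.

Local Notation d2phi := (second_subderivative phi xbar vbar).
Local Notation d2theta := (second_subderivative theta (f xbar)).

(** The formula is attained at the multiplier that duality produces for the
    curvature vector [z], and its value is approached along every small step. *)
Lemma second_subderivative_attained w : exists lambda,
  [/\ multipliers theta f xbar vbar lambda,
      d2phi w = (d2theta lambda (w *m 'J f xbar)
                 + (dotp lambda (second_derivative f xbar w w))%:E)%E &
      d2phi w = +oo%E \/ exists2 b : R, d2phi w = b%:E &
        forall e, 0 < e -> \forall t \near 0^'+, exists w', `|w' - w| < e /\
          (second_quotient phi xbar vbar t w' <= (b + e)%:E)%E].
Proof.
have [phiE td thetaNy [theta_conv theta_pwlq] msqc] := phi_sub.
have dy : edom theta (f xbar) by rewrite /edom /= -(nbhs_singleton phiE).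
have [L L0 /nbhs_normP[r' /= r'0 lip']] :=
  th_locally_lipschitz thetaNy theta_conv theta_pwlq (f xbar).
pose r := Num.min r' 1; have r0 : 0 < r by rewrite lt_min r'0 ltr01.
have lip y y' : `|y - f xbar| < r -> `|y' - f xbar| < r ->
    edom theta y -> edom theta y' ->
    fine (theta y) - fine (theta y') <= L * `|y - y'|.
  rewrite !lt_min => /andP[yr _] /andP[_ y'1]; apply: lip' => //.
  by rewrite /ball_ /= distrC.
have [K K0 rest] := MSQC_restorable msqc.
set J := 'J f xbar; set z := second_derivative f xbar w w.
pose C := penalty K L 1 vbar J.
have C0 : 0 <= C by exact: penalty_ge0.
have pen u y' : edom theta y' -> dotp vbar u <=
    fine (theta y') - fine (theta (f xbar)) + C * `|u *m J - (y' - f xbar)|.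
  by move=> dy'; exact: (penalized_subgradient thetaNy theta_conv K0 L0 lip dy
    erefl r0 td phiE rest u vbar_sub dy').
(* The penalized inequality is positively homogeneous in [(u, g)]. *)
have pen_cone u g : epigraph_cone theta (f xbar) g ->
    dotp vbar u <= g.2 + C * `|u *m J - g.1|.
  case: g => d q [s [y [s0 dy' /= -> le]]].
  move: s0; rewrite le_eqVlt => /predU1P[s0|s0].
    have := pen u _ dy; rewrite !subrr add0r.
    by move: le; rewrite -s0 mul0r scale0r; lra.
  have := pen (s^-1 *: u) _ dy'; rewrite -(ler_pM2l s0) dotpZr mulrA.
  rewrite divff ?gt_eqF // mul1r mulrDr mulrCA.
  rewrite -{2}(gtr0_norm s0) -normrZ scalerBr -scalemxAl scalerA.
  by rewrite divff ?gt_eqF // scale1r; move: le; lra.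
have [lambda [lamJ lamG lamz]] :=
  penalized_duality z C0 (epigraph_cone_convex thetaNy theta_conv dy) pen_cone.
have lam_sub : subgradient theta (f xbar) lambda.
  move=> y' dy'; rewrite -lerBrDl.
  apply: (lamG (y' - f xbar, fine (theta y') - fine (theta (f xbar)))).
  by exists 1, y'; rewrite scale1r mul1r.
have lam_mult : multipliers theta f xbar vbar lambda.
  by split=> //; apply/subdifferentialP.
have below := second_subderivative_comp_ge thetaNy dy td phiE w lamJ.
have := second_subderivative_dichotomy thetaNy theta_pwlq (w *m J) dy lam_sub.
case=> [d2y|[Q Qle quad]].
  have d2phiy : d2phi w = +oo%E.
    by apply/eqP; rewrite -leye_eq; move: below; rewrite d2y addye.
  by exists lambda; split=> //; [rewrite d2phiy d2y addye|left].
have lam_w : dotp lambda (w *m J) = dotp vbar w.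
  by rewrite -lamJ dotp_mulmx trmxK.
rewrite lam_w in quad; pose b : R := Q + dotp lambda z.
have recov e : 0 < e -> \forall t \near 0^'+, exists w', `|w' - w| < e /\
    (second_quotient phi xbar vbar t w' <= (b + e)%:E)%E.
  move=> e0; have e2 : 0 < e / 2 by rewrite divr_gt0.
  have [u [[d q] [[s [y [s0 dy' /= dE le]]]]]] := lamz _ e2; rewrite dE => lt_e.
  have := parabolic_recovery thetaNy theta_conv K0 L0 lip dy erefl r0 td phiE
    rest u dy' s0 le e2 quad.
  apply: filterS => t [w' [w'w val]]; exists w'; split; first by lra.
  apply: (le_trans val); rewrite lee_fin; move: lt_e.
  by rewrite -/J -/z -/C /b; lra.
have above : (d2phi w <= b%:E)%E by exact: limf_einf_recovery.
have Qz : (b%:E <= d2theta lambda (w *m J) + (dotp lambda z)%:E)%E.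
  by rewrite EFinD leeD2r.
have d2phib : d2phi w = b%:E.
  by apply/eqP; rewrite eq_le above (le_trans Qz).
exists lambda; split=> //; last by right; exists b.
by apply/eqP; rewrite eq_le below andbT d2phib.
Qed.

End ChainRule.

Theorem theorem5p2 (R : realType) (n m : nat)
    (phi : 'rV[R]_n -> \bar R) (xbar : 'rV[R]_n)
    (theta : 'rV[R]_m -> \bar R) (f : 'rV[R]_n -> 'rV[R]_m)
    (phiNy : forall x : 'rV[R]_n, phi x != -oo%E)
    (xbar_dom : edom phi xbar)
    (phi_sub : fully_subamenable_with phi xbar theta f)
    (vbar : 'rV[R]_n) (vbar_sub : subdifferential phi xbar vbar) :
  properly_twice_epi_differentiable phi xbar vbar
  /\ forall w : 'rV[R]_n,
       is_maximum
         [set (second_subderivative theta (f xbar) lambda (w *m 'J f xbar)%R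
               + (dotp lambda (second_derivative f xbar w w))%:E)%E
         | lambda in multipliers theta f xbar vbar]
         (second_subderivative phi xbar vbar w).
Proof.
have attained := second_subderivative_attained xbar_dom phi_sub vbar_sub.
have phi_fin : phi xbar = (fine (phi xbar))%:E.
  by rewrite fineK // fin_numElt ltNye phiNy.
have at0 : (second_subderivative phi xbar vbar 0 <= 0%:E)%E.
  apply: (limf_einf_recovery (D := second_quotient phi xbar vbar)) => e e0.
  near=> t; exists 0; rewrite subrr normr0; split=> //.
  have phi0 : phi (xbar + t *: 0) = (fine (phi xbar))%:E.
    by rewrite scaler0 addr0.
  rewrite (second_quotient_fin _ phi_fin phi0) lee_fin dotp0r.
  by rewrite subrr sub0r mulr0 oppr0 mul0r add0r ltW.
split; last first.
  move=> w; split=> [|_ [lambda [lamJ _] <-]].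
    by have [lambda [lam_mult -> _]] := attained w; exists lambda.
  have [phiE td thetaNy _ _] := phi_sub.
  have dy : edom theta (f xbar) by rewrite /edom /= -(nbhs_singleton phiE).
  exact: second_subderivative_comp_ge.
split.
  apply: epi_converges_liminf => w a e le_a e0.
  have [_ [_ _ [d2y|[b d2b recov]]]] := attained w.
    by move: le_a; rewrite -/(second_subderivative _ _ _ _) d2y.
  have ba : b <= a.
    by move: le_a; rewrite -/(second_subderivative _ _ _ _) d2b lee_fin.
  apply: filterS (recov e e0) => t [w' [w'w val]]; exists w'; split=> //.
  by apply: (le_trans val); rewrite lee_fin lerD2r.
split=> [w|].
  by have [_ [_ _ [->|[b -> _]]]] := attained w.
by exists 0; exact: le_lt_trans at0 (ltry _).
Unshelve. all: by end_near. Qed.
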